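(* Let $D$ be a semicomplete multipartite digraph. The maximum number of arcs in a G-path of $D$ is equal to the maximum number of arcs contained in a 1-G-path-G-cycle subdigraph of $D$. Furthermore, a G-path of $D$ with the maximum number of arcs can be found in polynomial time.
   Context: All digraphs are finite, without loops or parallel arcs (2-cycles are allowed). A digraph $D$ is a semicomplete multipartite digraph if $V(D)$ has a partition into nonempty sets $V_1,\ldots,V_c$ (the partite sets) such that no arc has both ends in the same $V_i$ and any two vertices in different partite sets are joined by at least one arc. A G-path in $D$ is a sequence of $r\ge 1$ pairwise vertex-disjoint directed paths $P_1,\ldots,P_r$ of $D$ (a path may be a single vertex), $P_i$ going from $u_i$ to $v_i$, such that $v_i$ and $u_{i+1}$ lie in the same partite set for every $i\in[r-1]$. A G-cycle is either a directed cycle of $D$, or such a sequence of $r\ge1$ vertex-disjoint paths for which additionally $v_r$ and $u_1$ lie in the same partite set. The length (number of arcs) of a G-path or G-cycle is the number of arcs of $D$ it uses (the arcs of the paths $P_i$, resp. of the cycle). A 1-G-path-G-cycle subdigraph of $D$ is a collection consisting of one G-path and zero or more G-cycles of $D$, all pairwise vertex-disjoint; its number of arcs is the sum of their lengths. *)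

(* Defs.v *)
From mathcomp Require Import all_boot.

Set Implicit Arguments.
Unset Strict Implicit.
Unset Printing Implicit Defensive.

(** * Semicomplete multipartite digraphs

    A digraph on the finite vertex set [V] is its arc relation [D : rel V]:
    parallel arcs are excluded by this encoding, 2-cycles are allowed, and
    loops are excluded by the second clause of [semicomplete_multipartite]. *)

Section Digraph.
Variables (V : finType) (D : rel V) (P : {set {set V}}).

(* [partition P setT] includes that the members of [P] are nonempty. *)
Definition semicomplete_multipartite : Prop :=
  [/\ partition P [set: V],
      forall (A : {set V}) (u v : V), A \in P -> u \in A -> v \in A -> ~~ D u v
    & forall (A B : {set V}) (u v : V), A \in P -> B \in P -> A != B ->
        u \in A -> v \in B -> D u v || D v u].

Definition same_part (u v : V) : bool :=
  [exists A in P, (u \in A) && (v \in A)].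

(* A directed path is the sequence of its vertices; it has at least one. *)
Definition dipath (p : seq V) : bool :=
  if p is x :: s then path D x s && uniq p else false.

(* No loops, so a directed cycle has at least two vertices. *)
Definition dicycle (c : seq V) : bool :=
  [&& c != [::], cycle D c & uniq c].

Definition linked (p q : seq V) : bool :=
  match p, q with
  | x :: s, y :: _ => same_part (last x s) y
  | _, _ => false
  end.

(* [uniq (flatten ps)]: the paths are pairwise vertex-disjoint. *)
Definition disjoint_paths (ps : seq (seq V)) : bool :=
  [&& ps != [::], all dipath ps & uniq (flatten ps)].

Definition is_gpath (ps : seq (seq V)) : bool :=
  disjoint_paths ps && sorted linked ps.

Definition path_arcs (p : seq V) : nat := (size p).-1.

Definition paths_arcs (ps : seq (seq V)) : nat := \sum_(p <- ps) path_arcs p.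

Inductive gcycle : Type :=
  | DiCycle of seq V
  | PathCycle of seq (seq V).

(* [cycle linked ps] is [sorted linked ps] together with the link from the
   last path of [ps] back to the first; for [ps = [:: p]] it says that the two
   ends of [p] are in the same partite set. *)
Definition is_gcycle (C : gcycle) : bool :=
  match C with
  | DiCycle c => dicycle c
  | PathCycle ps => disjoint_paths ps && cycle linked ps
  end.

Definition gcycle_vertices (C : gcycle) : seq V :=
  match C with
  | DiCycle c => c
  | PathCycle ps => flatten ps
  end.

Definition gcycle_arcs (C : gcycle) : nat :=
  match C with
  | DiCycle c => size c
  | PathCycle ps => paths_arcs ps
  end.

(* A 1-G-path-G-cycle subdigraph: one G-path and a list of G-cycles. *)
Definition is_gpath_gcycles (S : seq (seq V) * seq gcycle) : bool :=
  [&& is_gpath S.1, all is_gcycle S.2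
    & uniq (flatten S.1 ++ flatten (map gcycle_vertices S.2))].

Definition gpath_gcycles_arcs (S : seq (seq V) * seq gcycle) : nat :=
  paths_arcs S.1 + \sum_(C <- S.2) gcycle_arcs C.

End Digraph.

(* [m] is the maximum of [f] over the objects satisfying [Q]. *)
Definition is_maximum (T : Type) (Q : T -> Prop) (f : T -> nat) (m : nat) : Prop :=
  (exists2 x, Q x & f x = m) /\ (forall x, Q x -> f x <= m).

(** * Time-bounded computation

    A random access machine with structured programs: natural-number registers
    and arrays with computed indices, under unit cost.  The only
    arithmetic is addition, truncated subtraction and comparison, so for
    a fixed program every number has, after [t] steps, bit length [O(t)] plus
    that of the input numbers; hence running times are polynomially related to those
    of Turing machines.  Multiplication is deliberately not primitive: with
    it, unit cost would not be a polynomial-time measure. *)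

Record state : Type := State {
  reg : nat -> nat;
  arr : nat -> nat -> nat
}.

Inductive expr : Type :=
  | Num of nat
  | Reg of nat
  | Arr of nat & expr
  | Add of expr & expr
  | Sub of expr & expr
  | Lt of expr & expr
  | Eq of expr & expr.

Fixpoint eval (s : state) (e : expr) : nat :=
  match e with
  | Num k => k
  | Reg x => reg s x
  | Arr a i => arr s a (eval s i)
  | Add e1 e2 => eval s e1 + eval s e2
  | Sub e1 e2 => eval s e1 - eval s e2
  | Lt e1 e2 => nat_of_bool (eval s e1 < eval s e2)
  | Eq e1 e2 => nat_of_bool (eval s e1 == eval s e2)
  end.

Inductive cmd : Type :=
  | Skip
  | SetReg of nat & expr
  | SetArr of nat & expr & expr
  | Seq of cmd & cmd
  | If of expr & cmd & cmd
  | While of expr & cmd.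

Definition set_reg (s : state) (x v : nat) : state :=
  State (fun y => if y == x then v else reg s y) (arr s).

Definition set_arr (s : state) (a i v : nat) : state :=
  State (reg s)
        (fun b j => if (b == a) && (j == i) then v else arr s b j).

(* [exec c s t s']: started in [s], program [c] halts in [s'] after [t] steps.
   An expression evaluation is charged one step: the expressions occurring in
   a program have bounded size, so this only affects the constant. *)
Inductive exec : cmd -> state -> nat -> state -> Prop :=
  | ExecSkip s : exec Skip s 1 s
  | ExecSetReg x e s : exec (SetReg x e) s 1 (set_reg s x (eval s e))
  | ExecSetArr a i e s :
      exec (SetArr a i e) s 1 (set_arr s a (eval s i) (eval s e))
  | ExecSeq c1 c2 s s1 s2 t1 t2 :
      exec c1 s t1 s1 -> exec c2 s1 t2 s2 -> exec (Seq c1 c2) s (t1 + t2) s2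
  | ExecIfTrue e c1 c2 s s1 t :
      eval s e != 0 -> exec c1 s t s1 -> exec (If e c1 c2) s t.+1 s1
  | ExecIfFalse e c1 c2 s s1 t :
      eval s e = 0 -> exec c2 s t s1 -> exec (If e c1 c2) s t.+1 s1
  | ExecWhileTrue e c s s1 s2 t1 t2 :
      eval s e != 0 -> exec c s t1 s1 -> exec (While e c) s1 t2 s2 ->
      exec (While e c) s (t1 + t2).+1 s2
  | ExecWhileFalse e c s :
      eval s e = 0 -> exec (While e c) s 1 s.

(* Input: the number [n] of vertices in register 0 and the row-major adjacency
   matrix in array 0; everything else is 0.  The partite sets are not part of
   the input: they are the classes of the nonadjacency relation. *)
Definition input_digraph (n : nat) (D : rel 'I_n) : state :=
  State (fun x => if x == 0 then n else 0)
        (fun a i => if a == 0 then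
           nat_of_bool [exists u : 'I_n, exists v : 'I_n,
                          (i == u * n + v) && D u v]
         else 0).

(* Output: the number of paths in register 1, the list of their numbers of
   vertices in array 1, and their vertices, concatenated, in array 2. *)
Definition outputs_paths (n : nat) (s : state) (ps : seq (seq 'I_n)) : Prop :=
  [/\ reg s 1 = size ps,
      mkseq (arr s 1) (size ps) = map size ps
    & mkseq (arr s 2) (size (flatten ps)) = map val (flatten ps)].

(* One program, and one polynomial bound [C * n ^ k + C] in the number [n] of
   vertices (equivalently, in the size of the adjacency matrix), such that on
   every digraph on [n] vertices satisfying [inst] the program halts within
   the bound and outputs a solution. *)
Definition paths_found_in_polytime
    (inst : forall n : nat, rel 'I_n -> Prop)
    (sol : forall n : nat, rel 'I_n -> seq (seq 'I_n) -> Prop) : Prop :=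
  exists (c : cmd) (C k : nat),
    forall (n : nat) (D : rel 'I_n), inst n D ->
    exists (t : nat) (s : state) (ps : seq (seq 'I_n)),
      [/\ exec c (input_digraph D) t s,
          t <= C * n ^ k + C,
          outputs_paths s ps
        & sol n D ps].

Definition maximum_gpath (V : finType) (D : rel V) (P : {set {set V}})
    (ps : seq (seq V)) : Prop :=
  is_gpath D P ps /\ forall qs, is_gpath D P qs -> paths_arcs qs <= paths_arcs ps.

(* Main.v *)
Require Import Defs.
From mathcomp Require Import all_boot fingroup perm.
From mathcomp Require Import zify.

(** Add to the vertices a point z joined to all of them in both directions.  A
    G-path with disjoint G-cycles becomes a permutation s of the points whose
    moves x -> s x are arcs, or stay inside a partite set, or involve z; the
    G-path is the cycle of s through z, and the length is the number of moves
    that are arcs.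

    Cycles merge without loss.  Let z, p_1, ..., p_k be the cycle through z and
    C another cycle.  If C cannot be opened and inserted between two consecutive
    points, let p_i be the last point before the first one that has an arc from
    C, and S the partite set of p_i.  By induction on l >= i, every c in C with
    an arc to p_l lies outside S while its successor on C lies in S, unless C
    can be cut into two segments inserted after p_i and after p_l.  For l = k
    this is contradictory.

    A permutation with the maximum number of arcs solves an assignment problem,
    for which an auction with unit price increments is polynomial because the
    weights are.  Merging is then done by trying all quadruples of points, and
    the paths are read off along the cycle through z. *)

Set Implicit Arguments.
Unset Strict Implicit.
Unset Printing Implicit Defensive.

(** Moves at z are free: all but z -> z are admissible, and none counts as an arc. Inserting C next
    to z therefore costs at most the arc at which C is opened, and this settles both ends of the
    cycle through z. The obstacle lies in between, where opening C at a single place may lose an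
    arc. There C has to be cut twice, which is why a rotation involves four points and not just two.
    Only the existence of the four points is proved. The program never identifies C, S or the
    partite sets: it accepts any rotation that keeps the total weight and lengthens the cycle
    through z. From a maximum every accepted rotation leads to a maximum, so n.+1 passes leave a
    single cycle. The auction suits loops whose number of rounds is fixed beforehand, because the
    sum of its prices acts as a clock. *)

Local Notation forder := fingraph.order.

(** * Merging cycles of a permutation *)

Section Rotation.
Variables (T : finType).
Local Open Scope group_scope.
Implicit Types (s : {perm T}) (a b c d x y z : T).

Definition swap s a b : {perm T} := tperm a b * s.

Lemma swapE s a b x : swap s a b x = s (tperm a b x).
Proof. by rewrite /swap permM. Qed.

(* The cyclic shift s a <- s b <- s c <- s d <- s a of the images, written as
   three exchanges because the program performs it so; for b = c = d it is a
   single exchange. *)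
Definition rotate s a b c d : {perm T} := swap (swap (swap s a b) b c) c d.

Lemma rotate_transposition s a b : rotate s a b b b = swap s a b.
Proof. by apply/permP => x; rewrite /rotate !swapE !tperm1 !perm1. Qed.

Lemma rotateE s a b c d : uniq [:: a; b; c; d] ->
  [/\ rotate s a b c d a = s b, rotate s a b c d b = s c,
      rotate s a b c d c = s d, rotate s a b c d d = s a
    & forall x, x \notin [:: a; b; c; d] -> rotate s a b c d x = s x].
Proof.
rewrite /= !inE !negb_or => /and4P[/and3P[ab ac ad] /andP[bc bd] cd _].
have [ba ca da cb db] : [/\ b != a, c != a, d != a, c != b & d != b].
  by split; rewrite eq_sym.
have dc : d != c by rewrite eq_sym.
rewrite /rotate !swapE !tpermL !tpermR.
rewrite (@tpermD _ c d a) // (@tpermD _ b c a) // tpermL.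
rewrite (@tpermD _ c d b) // tpermL (@tpermD _ a b c) //.
rewrite (@tpermD _ b c d) // (@tpermD _ a b d) //.
split=> // x; rewrite !inE !negb_or => /and4P[xa xb xc xd].
by rewrite !swapE !tpermD // eq_sym.
Qed.

(** A rotation alters [s] at no more than four points. The segments of the old cycles between these
    points survive, and the new cycle is followed along them. *)
Lemma fconnect_segment (f g : T -> T) x i j : i <= j ->
  (forall m, i <= m < j -> f (iter m g x) = iter m.+1 g x) ->
  fconnect f (iter i g x) (iter j g x).
Proof.
elim: j => [|j IHj]; first by rewrite leqn0 => /eqP-> _; apply: connect0.
rewrite leq_eqVlt => /predU1P[-> _|]; first exact: connect0.
rewrite ltnS => le_ij eq_fg.
apply: (connect_trans (IHj le_ij _)) => [m /andP[im mj]|].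
  by apply: eq_fg; rewrite im ltnW.
by rewrite -eq_fg ?le_ij ?leqnn //; apply: fconnect1.
Qed.

Lemma iter_neq_findex s x y m : m < forder s x -> m != findex s x y ->
  iter m s x != y.
Proof. by move=> lt_m; apply: contraNneq => <-; rewrite findex_iter. Qed.

Lemma order_lt_fconnect s s' z c : ~~ fconnect s z c -> fconnect s' z c ->
  (forall j, j < forder s z -> fconnect s' z (iter j s z)) ->
  forder s z < forder s' z.
Proof.
move=> szc s'zc sub; apply: proper_card; apply/properP; split; last first.
  by exists c.
apply/subsetP => x; rewrite inE => /[dup] zx /iter_findex <-.
by apply: sub; apply: findex_max.
Qed.

(** Exchanging images on two different cycles joins them: the new cycle runs from z to a, from [s c]
    around to c, and from [s a] back to z. *)
Lemma order_swap s z a c : fconnect s z a -> ~~ fconnect s z c ->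
  forder s z < forder (swap s a c) z.
Proof.
move=> za zc; set f := swap s a c.
have zN m : iter m s z != c.
  by apply: contraNneq zc => <-; apply: fconnect_iter.
have cN m : iter m s c != a.
  apply: contraNneq zc => e; apply: (connect_trans za).
  by rewrite (fconnect_sym perm_inj) -e fconnect_iter.
have fE x : x != a -> x != c -> f x = s x.
  by move=> xa xc; rewrite /f swapE tpermD // eq_sym.
have al : iter (findex s z a) s z = a by rewrite iter_findex.
have to_a j : j <= findex s z a -> fconnect f z (iter j s z).
  move=> jl; apply: (@fconnect_segment f s z 0) => // m /andP[_ mj].
  apply: fE => //; apply: iter_neq_findex; last by rewrite ltn_eqF // (leq_trans mj).
  by apply: leq_trans (findex_max za); apply: leq_trans mj _; apply: leqW.
have to_c : fconnect f z c.
  have := to_a _ (leqnn _); rewrite al => /connect_trans; apply.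
  apply: (@connect_trans _ _ (f a)); first exact: fconnect1.
  have ->: f a = iter 1 s c by rewrite /f swapE tpermL.
  rewrite -{2}(iter_order (@perm_inj _ s) c).
  apply: fconnect_segment => [|m /andP[m1 mc]].
    exact: fingraph.order_gt0.
  by apply: fE => //; apply: iter_neq_findex => //; rewrite findex0 -lt0n.
apply: (order_lt_fconnect zc to_c) => j jz.
case: (leqP j (findex s z a)) => [/to_a //|lj].
apply: (connect_trans to_c).
apply: (@connect_trans _ _ (f c)); first exact: fconnect1.
have ->: f c = iter (findex s z a).+1 s z by rewrite /f swapE tpermR iterS al.
apply: fconnect_segment => // m /andP[lm mj]; apply: fE => //.
by apply: iter_neq_findex; [apply: ltn_trans jz | rewrite gtn_eqF].
Qed.

(** With a and b the points at i and l, the new cycle consists of the segments z .. a, [s c] .. d,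
    [s a] .. b, [s d] .. c, [s b] .. z. *)
Lemma order_rotate s z i l c d : i < l < forder s z -> ~~ fconnect s z c ->
  fconnect s c d -> c != d ->
  forder s z < forder (rotate s (iter i s z) c (iter l s z) d) z.
Proof.
move=> /andP[il lz] zc cd c_d; set a := iter i s z; set b := iter l s z.
have iz := ltn_trans il lz.
have zN x m : fconnect s c x -> iter m s z != x.
  move=> cx; apply: contraNneq zc => e; apply: (@connect_trans _ _ x).
    by rewrite -e; apply: fconnect_iter.
  by rewrite (fconnect_sym perm_inj).
have cN x m k : fconnect s c x -> iter m s x != iter k s z.
  move=> cx; rewrite eq_sym; apply: zN.
  by apply: connect_trans cx _; apply: fconnect_iter.
have cc : fconnect s c c by [].
have dc : fconnect s d c by rewrite (fconnect_sym perm_inj).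
have iterN m m' : m < forder s z -> m' < forder s z -> m != m' ->
    iter m s z != iter m' s z.
  by move=> mz mz' mm; apply: iter_neq_findex; rewrite ?findex_iter.
have ab : a != b by apply: iterN => //; rewrite ltn_eqF.
have [] := @rotateE s a c b d.
  rewrite /= !inE !negb_or ab (zN _ _ cc) (zN _ _ cd) c_d (zN _ _ cd) andbT /=.
  by rewrite eq_sym (zN _ _ cc).
set f := rotate s a c b d => fa fc fb fd f_eq.
have fE x : x != a -> x != c -> x != b -> x != d -> f x = s x.
  by move=> *; apply: f_eq; rewrite !inE !negb_or; apply/and4P.
have along_z m : m < forder s z -> m != i -> m != l ->
    f (iter m s z) = iter m.+1 s z.
  by move=> mz mi ml; apply: fE; [apply: iterN|apply: zN|apply: iterN|apply: zN].
(* c and d divide their cycle into two segments, from [s c] to d and from [s d] to c; the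
   disjunction covers both. *)
have along_c x y : fconnect s c x -> x != y -> fconnect s x y ->
    [|| (x == c) && (y == d) | (x == d) && (y == c)] ->
    fconnect f (s x) y.
  move=> cx xy x_y xy_cd; rewrite -(iter_findex x_y).
  have gt0 : 0 < findex s x y by rewrite lt0n findex_eq0.
  apply: (@fconnect_segment f s x 1) => // m /andP[m1 mr].
  have mx : m < forder s x by apply: ltn_trans mr (findex_max x_y).
  have [m_x m_y] : iter m s x != x /\ iter m s x != y.
    by split; apply: iter_neq_findex; rewrite // ?findex0 -?lt0n // ltn_eqF.
  apply: fE; rewrite ?cN //; case/orP: xy_cd => /andP[/eqP ex /eqP ey];
    by rewrite -?ex -?ey.
have z_a : fconnect f z a.
  apply: (@fconnect_segment f s z 0) => // m /andP[_ mi].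
  by apply: along_z; rewrite ?ltn_eqF // (ltn_trans mi) // ltnW.
have step x y : fconnect f z x -> f x = y -> fconnect f z y.
  by move=> zx <-; apply: connect_trans zx (fconnect1 _ _).
have z_d : fconnect f z d.
  apply: connect_trans (step _ _ z_a fa) _; apply: along_c => //.
  by rewrite !eqxx.
have z_Sa j : i < j <= l -> fconnect f z (iter j s z).
  move=> /andP[ij jl]; apply: connect_trans (step _ _ z_d fd) _.
  apply: (@fconnect_segment f s z i.+1) => // m /andP[im mj].
  have ml := leq_trans mj jl.
  by apply: along_z; rewrite ?(gtn_eqF im) ?(ltn_eqF ml) // (ltn_trans ml).
have z_b : fconnect f z b by apply: z_Sa; rewrite il leqnn.
have z_c : fconnect f z c.
  apply: connect_trans (step _ _ z_b fb) _; apply: along_c => //.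
    by rewrite eq_sym.
  by rewrite !eqxx orbT.
apply: (order_lt_fconnect zc z_c) => j jz.
case: (leqP j i) => [ji|ij].
  apply: (@fconnect_segment f s z 0) => // m /andP[_ mj].
  have mi := leq_trans mj ji.
  by apply: along_z; rewrite ?(ltn_eqF mi) ?ltn_eqF // (ltn_trans mi) // ltnW.
case: (leqP j l) => [jl|lj]; first by apply: z_Sa; rewrite ij.
apply: connect_trans (step _ _ z_c fc) _.
apply: (@fconnect_segment f s z l.+1) => // m /andP[lm mj].
apply: along_z; rewrite ?(gtn_eqF lm) ?(gtn_eqF (ltn_trans il lm)) //.
exact: ltn_trans mj jz.
Qed.

End Rotation.

(** * Absorbing a cycle into the cycle through z *)

Section Merge.
Variables (T : finType) (z : T) (D : rel T).
Implicit Types (s : {perm T}) (x y : T).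

Definition nonadjacent x y := ~~ D x y && ~~ D y x.

(* Moves inside a partite set, fixed points included, are admissible, as are
   all moves from or to z except z -> z. *)
Definition admissible x y :=
  if (x == z) || (y == z) then (x != z) || (y != z) else D x y || ~~ D y x.

Definition arc_count s := \sum_x D x (s x).

Definition admissible_perm s := [forall x, admissible x (s x)].

Definition improves s s' :=
  [&& admissible_perm s', arc_count s <= arc_count s' &
      forder s z < forder s' z].

(** [D] has no arc at z, so moves at z do not count; it is [admissible] that makes them free. Hence
    z is nonadjacent to every point, and transitivity of nonadjacency has to leave it out. *)
Hypothesis D_apex : forall x, ~~ D z x /\ ~~ D x z.
Hypothesis D_irr : forall x, ~~ D x x.
Hypothesis nonadjacent_trans : forall y x t,
  x != z -> y != z -> t != z ->
  nonadjacent x y -> nonadjacent y t -> nonadjacent x t.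

Lemma nonadjacent_sym x y : nonadjacent x y = nonadjacent y x.
Proof. by rewrite /nonadjacent andbC. Qed.

Lemma arc_count_le s s' (r : seq T) : uniq r ->
  (forall x, x \notin r -> s' x = s x) ->
  \sum_(x <- r) D x (s x) <= \sum_(x <- r) D x (s' x) ->
  arc_count s <= arc_count s'.
Proof.
move=> r_uniq off; rewrite !big_uniq // => le_r.
rewrite /arc_count (bigID [in r]) [leqRHS](bigID [in r]) /=.
by rewrite leq_add //; apply: leq_sum => x /off ->.
Qed.

Lemma admissible_perm_off s s' (r : seq T) : admissible_perm s ->
  (forall x, x \notin r -> s' x = s x) -> all (fun x => admissible x (s' x)) r ->
  admissible_perm s'.
Proof.
move=> /forallP ok_s off /allP ok_r; apply/forallP => x.
by case: (boolP (x \in r)) => [/ok_r|/off ->].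
Qed.

Lemma improves_swap s a c : admissible_perm s -> fconnect s z a ->
  ~~ fconnect s z c -> admissible a (s c) -> admissible c (s a) ->
  D a (s a) + D c (s c) <= D a (s c) + D c (s a) ->
  improves s (rotate s a c c c).
Proof.
move=> ok_s za zc ok_a ok_c le_D; rewrite rotate_transposition.
have a_c : a != c by apply: contraTneq za => ->.
have off x : x \notin [:: a; c] -> swap s a c x = s x.
  by rewrite !inE negb_or swapE => /andP[xa xc]; rewrite tpermD // eq_sym.
apply/and3P; split; last exact: order_swap.
  apply: (admissible_perm_off ok_s off).
  by rewrite /= !swapE tpermL tpermR ok_a ok_c.
apply: (arc_count_le _ off); first by rewrite /= inE a_c.
by rewrite !big_cons !big_nil !swapE tpermL tpermR !addn0.
Qed.

(** All four new moves are arcs, so the count cannot drop at the four changed points. *)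
Lemma improves_rotate s i l c d (a := iter i s z) (b := iter l s z) :
  admissible_perm s -> i < l < forder s z -> ~~ fconnect s z c ->
  fconnect s c d -> c != d ->
  D a (s c) -> D c (s b) -> D b (s d) -> D d (s a) ->
  improves s (rotate s a c b d).
Proof.
move=> ok_s il zc cd c_d ac cb bd da.
have zd : ~~ fconnect s z d.
  by apply: contra zc => zd; rewrite (connect_trans zd) // (fconnect_sym perm_inj).
have iN m x : ~~ fconnect s z x -> iter m s z != x.
  by apply: contraNneq => <-; apply: fconnect_iter.
have /andP[i_l lz] := il.
have ab : a != b.
  apply: iter_neq_findex; first exact: ltn_trans lz.
  by rewrite findex_iter // ltn_eqF.
have uniq_r : uniq [:: a; c; b; d].
  by rewrite /= !inE !negb_or ab !iN // c_d eq_sym !iN.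
have [fa fc fb fd off] := rotateE s uniq_r.
have D_ok x y : D x y -> admissible x y.
  have [[/negPf zy /negPf yz] [/negPf zx /negPf xz]] := (D_apex y, D_apex x).
  rewrite /admissible => /[dup] xy ->.
  by case: eqP xy => [->|_]; rewrite ?zy //; case: eqP => [->|_]; rewrite ?xz.
apply/and3P; split; last exact: order_rotate.
  apply: (admissible_perm_off ok_s off).
  by rewrite /= fa fb fc fd !D_ok.
apply: (arc_count_le uniq_r off).
rewrite !big_cons !big_nil fa fb fc fd ac cb bd da.
by do 4!case: (D _ _).
Qed.

Theorem merge_cycle s : admissible_perm s -> forder s z < #|T| ->
  [exists a, exists b, exists c, exists d, improves s (rotate s a b c d)].
Proof.
move=> ok_s not_full; apply: contraT => stuck.
have no_improvement a b c d : ~ improves s (rotate s a b c d).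
  move=> abcd; case/negP: stuck; apply/existsP; exists a; apply/existsP.
  by exists b; apply/existsP; exists c; apply/existsP; exists d.
have /subsetPn[e _ ze] : ~~ ([set: T] \subset fconnect s z).
  by apply/negP => /subset_leq_card; rewrite cardsT leqNgt not_full.
pose C := fconnect s e.
have CS c : C c -> C (s c).
  by move=> ec; apply: connect_trans ec (fconnect1 _ _).
have zC c : C c -> ~~ fconnect s z c.
  move=> ec; apply: contra ze => zc; apply: connect_trans zc _.
  by rewrite (fconnect_sym perm_inj).
have Cz c : C c -> c != z by move/zC; apply: contraNneq => ->.
have Cconn c d : C c -> C d -> fconnect s c d.
  by rewrite /C (fconnect_sym perm_inj); apply: connect_trans.
(* The cycle through z is p 0 = z, p 1, ..., p k, closed by p k.+1 = z. *)
have [k ordk] : exists k, forder s z = k.+1.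
  by exists (forder s z).-1; rewrite prednK // fingraph.order_gt0.
pose p l := iter l s z.
have pS l : s (p l) = p l.+1 by [].
have p_end : p k.+1 = z by rewrite /p -ordk; apply: iter_order perm_inj _.
have zp l : fconnect s z (p l) by apply: fconnect_iter.
have pz l : 0 < l <= k -> p l != z.
  case/andP=> l0 lk; apply: iter_neq_findex; first by rewrite ordk.
  by rewrite findex0 -lt0n.
have okNz x y : x != z -> y != z -> admissible x y = D x y || ~~ D y x.
  by rewrite /admissible => /negPf-> /negPf->.
have okz x : x != z -> admissible z x /\ admissible x z.
  by rewrite /admissible eqxx orbT => ->; rewrite orbT.
(* The cycle of c, opened after c, placed between p l and p l.+1. *)
have insertion l c : C c -> admissible (p l) (s c) -> admissible c (p l.+1) ->
    D (p l) (s c) + D c (p l.+1) < D (p l) (p l.+1) + D c (s c).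
  move=> Cc ok1 ok2; rewrite ltnNge; apply/negP => le_D.
  by apply: (@no_improvement (p l) c c c); apply: improves_swap; rewrite ?pS ?zC.
have D_z x : (D z x = false) * (D x z = false).
  by have [/negPf-> /negPf->] := D_apex x.
have adjP x y : [|| D x y, D y x | nonadjacent x y].
  by rewrite /nonadjacent; do 2!case: (D _ _).
(* k = 0 would mean z -> z, the one inadmissible move at z. *)
have k_gt0 : 0 < k.
  rewrite lt0n; apply/eqP => k0.
  have /forallP/(_ z) := ok_s; have:= p_end; rewrite k0 /p /= => ->.
  by rewrite /admissible !eqxx.
(* An arc from c to p 1 would pay for opening C after c and inserting it between z and p 1. *)
have I1 c : C c -> ~~ D c (p 1).
  move=> Cc; apply/negP => c1.
  have := @insertion 0 c Cc (proj1 (okz _ (Cz _ (CS _ Cc)))).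
  rewrite okNz ?pz ?Cz // c1 /p /= !D_z => /(_ isT).
  by case: (D _ _).
(* Symmetrically at the other end: here C would be opened before c and inserted between p k and
   z. *)
have Ok c : C c -> ~~ D (p k) c.
  move=> Cc; apply/negP => kc.
  pose c' := (s^-1)%g c.
  have Cc' : C c'.
    by apply: connect_trans Cc _; rewrite (fconnect_sym perm_inj) -(permKV s c) fconnect1.
  have := @insertion k c' Cc'.
  rewrite permKV p_end okNz ?pz ?k_gt0 ?leqnn ?Cz // kc => /(_ isT).
  move/(_ (proj2 (okz _ (Cz _ Cc')))); rewrite !D_z.
  by case: (D _ _).
have adm_arc x y : x != z -> y != z -> ~~ D y x -> admissible x y.
  by move=> xz yz yx; rewrite okNz // yx orbT.
have adm_D x y : x != z -> y != z -> D x y -> admissible x y.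
  by move=> xz yz xy; rewrite okNz // xy.
(* Otherwise all of C is nonadjacent to p k, hence e to [s e]; opening C after e then loses no arc,
   and C fits between p k and z. *)
have [c0 Cc0 c0k] : exists2 c, C c & D c (p k).
  case: (boolP [exists c, C c && D c (p k)]) => [/existsP[c /andP[]]|none].
    by exists c.
  have kN c : C c -> nonadjacent (p k) c.
    move=> Cc; rewrite /nonadjacent Ok //.
    by apply: contra none => ck; apply/existsP; exists c; rewrite Cc.
  have Ce : C e by apply: connect0.
  have kz : p k != z by rewrite pz // k_gt0 leqnn.
  have /andP[/negPf eSe _] : nonadjacent e (s e).
    have ek : nonadjacent e (p k) by rewrite nonadjacent_sym kN.
    by apply: nonadjacent_trans ek (kN _ (CS _ Ce)); auto.
  have /andP[_ Sek] := kN _ (CS _ Ce).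
  have := @insertion k e Ce (adm_arc _ _ kz (Cz _ (CS _ Ce)) Sek).
  by rewrite p_end eSe !D_z => /(_ (proj2 (okz e (Cz _ Ce)))).
pose hit j := [exists c, C c && D c (p j)].
have exh : exists j, hit j by exists k; apply/existsP; exists c0; rewrite Cc0.
have hitP j c : C c -> D c (p j) -> hit j.
  by move=> Cc cj; apply/existsP; exists c; rewrite Cc.
(* The first point with an arc from C is neither z nor p 1. It is written p i.+2, so the point
   before it, whose partite set is [S], is p i.+1. *)
case: (ex_minnP exh) => -[|[|i]] hit_i min_i.
- by case/existsP: hit_i => c; rewrite D_z andbF.
- by case/existsP: hit_i => c /andP[Cc]; rewrite (negPf (I1 _ Cc)).
have ik : i.+1 < k := min_i _ (hitP _ _ Cc0 c0k).
have{min_i} notI c : C c -> ~~ D c (p i.+1).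
  by move=> Cc; apply: contraL (leqnn i.+2) => /(hitP _ _ Cc)/min_i; rewrite ltnNge.
case/existsP: hit_i => d0 /andP[Cd0 d0i].
pose S x := nonadjacent (p i.+1) x.
have iz : p i.+1 != z by rewrite pz //= ltnW.
have S_nonadj x y : x != z -> y != z -> S x -> S y -> nonadjacent x y.
  move=> xz yz Sx; apply: nonadjacent_trans => //.
  by rewrite nonadjacent_sym.
have S_trans x y : x != z -> y != z -> S x -> nonadjacent x y -> S y.
  by move=> xz yz; apply: nonadjacent_trans.
(* Invariant along the path, from the last p i.+1 with no arc from C; at l = k
   it contradicts the absence of arcs from p k to C. *)
pose J l := forall c, C c -> D c (p l) -> S (s c) /\ ~~ S c.
have insNS l c : i < l < k -> C c -> D c (p l.+1) -> ~~ D (p l) (s c).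
  move=> /andP[il lk] Cc cl; apply/negP => lc.
  have lz : p l != z by rewrite pz // (leq_ltn_trans _ il) // ltnW.
  have := @insertion l c Cc (adm_D _ _ lz (Cz _ (CS _ Cc)) lc).
  rewrite lc cl => /(_ (adm_D _ _ (Cz _ Cc) (pz l.+1 lk) cl)).
  by do 2!case: (D _ _).
have insS l c : i < l < k -> C c -> D c (p l.+1) -> nonadjacent (p l) (s c) ->
    D (p l) (p l.+1) && D c (s c).
  move=> /andP[il lk] Cc cl /andP[lc Scl].
  have lz : p l != z by rewrite pz // (leq_ltn_trans _ il) // ltnW.
  have := @insertion l c Cc (adm_arc _ _ lz (Cz _ (CS _ Cc)) Scl).
  rewrite (negPf lc) cl => /(_ (adm_D _ _ (Cz _ Cc) (pz l.+1 lk) cl)).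
  by do 2!case: (D _ _).
(* By [J l] no x in S has an arc to p l, and x is adjacent to p l, which lies outside S; so the arc
   goes from p l to x. *)
have SO l x : i < l <= k -> J l -> C x -> S x -> ~~ S (p l) -> D (p l) x.
  move=> /andP[il lk] Jl Cx Sx Sl; have lz : p l != z by rewrite pz // (leq_ltn_trans _ il).
  case/or3P: (adjP (p l) x) => // [xl|lx].
    by have [_ /negP] := Jl _ Cx xl.
  by case/negP: Sl; apply: (S_trans _ _ (Cz _ Cx) lz Sx); rewrite nonadjacent_sym.
have J_all l : i < l <= k -> J l.
  (* Strong induction: one case below needs the two preceding indices, another needs [J] at i.+2. *)
  elim/ltn_ind: l => -[//|l] IH /andP[]; rewrite ltnS leq_eqVlt => /predU1P[<- _ c Cc|il lk].
    by rewrite (negPf (notI _ Cc)).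
  have Jl : J l by apply: IH; rewrite // il ltnW.
  have lik : i < l < k by rewrite il.
  have lz : p l != z by rewrite pz // (ltnW lk) (leq_ltn_trans _ il).
  move=> c Cc cl; have CSc := CS _ Cc.
  have [Sl|Sl] := boolP (S (p l)); have [Sc|Sc] := boolP (S (s c)).
  - split=> //; apply/negP => Sc'.
    have := insS _ _ lik Cc cl (S_nonadj _ _ lz (Cz _ CSc) Sl Sc).
    have /andP[/negPf-> _] := S_nonadj _ _ (Cz _ Cc) (Cz _ CSc) Sc' Sc.
    by rewrite andbF.
  (* Here [s c] has an arc to p l, so [J l] puts s (s c) into S. Look at the point before p l: if it
     is in S, [insS] demands an arc inside S; if not, it has an arc to s (s c), contrary to
     [insNS]. *)
  - have {}cl : D (s c) (p l).
      case/or3P: (adjP (p l) (s c)) => // [lc|lc].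
        by case/negP: (insNS _ _ lik Cc cl).
      by case/negP: Sc; apply: (S_trans _ _ lz (Cz _ CSc) Sl).
    have [SSc _] := Jl _ CSc cl; have CSSc := CS _ CSc.
    case: l IH il lk Jl lik lz Sl cl => // l IH.
    rewrite ltnS leq_eqVlt => /predU1P[<-|il] lk _ _ lz Sl cl.
      by case/negP: (notI _ CSc).
    have lk' : i < l < k by rewrite il (ltn_trans _ lk).
    have lz' : p l != z by rewrite pz // (leq_ltn_trans _ il) // (ltnW (ltn_trans _ lk)).
    have [Sl'|Sl'] := boolP (S (p l)).
      have := insS _ _ lk' CSc cl (S_nonadj _ _ lz' (Cz _ CSSc) Sl' SSc).
      by have /andP[/negPf-> _] := S_nonadj _ _ lz' lz Sl' Sl.
    case/negP: (insNS _ _ lk' CSc cl); apply: SO => //.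
      by rewrite il ltnW // (ltn_trans _ lk).
    by apply: IH; rewrite ?il ?ltnS ?leqnSn // ltnW // (ltn_trans _ lk).
  - split=> //; apply/negP => Sc'; case/negP: (insNS _ _ lik Cc cl).
    by apply: SO; rewrite // il ltnW.
  - have i2l : i.+1 < l.
      rewrite ltn_neqAle il andbT; apply: contraNneq Sl => <-.
      by rewrite /S /nonadjacent (negPf (D_irr _)).
    have [SSd0 Sd0] : S (s d0) /\ ~~ S d0.
      have ri : i < i.+2 <= k by rewrite leqnSn.
      exact: (IH i.+2 i2l ri d0 Cd0 d0i).
    have iSc : D (p i.+1) (s c).
      case/or3P: (adjP (p i.+1) (s c)) => // [sci|isc]; last by case/negP: Sc.
      by case/negP: (notI _ CSc).
    (* C is cut into two segments, placed after p i.+1 and after p l. *)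
    case: (@no_improvement (p i.+1) c (p l) d0).
    apply: improves_rotate; rewrite ?ordk ?zC ?pS ?i2l //.
    - exact: ltnW.
    - exact: Cconn.
    - by apply: contraNneq Sc => ->.
    - apply: SO; rewrite ?CS //.
      by rewrite il ltnW.
(* The contradiction at l = k: p k.-1 must lie in S, hence p k, to which it has an arc, does not. So
   p k and [s c0] are adjacent, but [Ok] forbids one direction and [J k] the other. *)
have [Sc Sc'] : S (s c0) /\ ~~ S c0 by apply: (J_all k); rewrite // (ltnW ik) leqnn.
have kE : k.-1.+1 = k by apply: prednK.
have k1 : i < k.-1 < k by rewrite -ltnS kE ik leqnn.
have [Jk kz] : J k.-1 /\ p k.-1 != z.
  case/andP: k1 => ik1 k1k; split; first by apply: J_all; rewrite ik1 ltnW.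
  by rewrite pz // (leq_ltn_trans _ ik1) // ltnW.
have c0k1 : D c0 (p k.-1.+1) by rewrite kE.
have CSc0 := CS _ Cc0.
have [Sk|Sk] := boolP (S (p k.-1)); last first.
  case/negP: (insNS _ _ k1 Cc0 c0k1); apply: SO => //.
  by case/andP: k1 => -> /ltnW.
have := insS _ _ k1 Cc0 c0k1 (S_nonadj _ _ kz (Cz _ CSc0) Sk Sc).
rewrite kE => /andP[kk _].
have kz' : p k != z by rewrite pz // k_gt0 leqnn.
have {}Sk : ~~ S (p k).
  by apply: contraL kk => Sk'; case/andP: (S_nonadj _ _ kz kz' Sk Sk').
case/or3P: (adjP (p k) (s c0)) => [k0|k0|k0].
- by case/negP: (Ok _ CSc0).
- by have [_ /negP] := J_all k (introT andP (conj (ltnW ik) (leqnn k))) _ CSc0 k0.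
- by case/negP: Sk; apply: (S_trans _ _ (Cz _ CSc0) kz' Sc); rewrite nonadjacent_sym.
Qed.

End Merge.

(** * G-paths and permutations of the vertices with an apex *)

Section ConsecutiveSum.
Variables (T : eqType) (F : T -> T -> nat).

Fixpoint consecutive_sum x s :=
  if s is y :: s' then F x y + consecutive_sum y s' else 0.

Lemma consecutive_sum_cat x s t :
  consecutive_sum x (s ++ t) = consecutive_sum x s + consecutive_sum (last x s) t.
Proof. by elim: s x => //= y s IHs x; rewrite IHs addnA. Qed.

Lemma consecutive_sum_nth x0 x s :
  consecutive_sum x s = \sum_(i < size s) F (nth x0 (x :: s) i) (nth x0 s i).
Proof.
elim: s x => [|y s IHs] x /=; first by rewrite big_ord0.
by rewrite big_ord_recl /= IHs.
Qed.

Lemma consecutive_sum_next x s : uniq (x :: s) ->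
  \sum_(y <- x :: s) F y (next (x :: s) y) = consecutive_sum x (rcons s x).
Proof.
move=> Us; rewrite (consecutive_sum_nth x) size_rcons (big_nth x) big_mkord.
apply: eq_bigr => i _; rewrite next_nth mem_nth // index_uniq //.
rewrite -rcons_cons !nth_rcons ltn_ord; congr (F _ _).
have := ltn_ord i; rewrite ltnS leq_eqVlt => /predU1P[->|->] //.
by rewrite ltnn eqxx nth_default.
Qed.

End ConsecutiveSum.

Lemma consecutive_sum_path (T : eqType) (e : rel T) x s :
  path e x s -> consecutive_sum e x s = size s.
Proof. by elim: s x => //= y s IHs x /andP[-> /IHs->]. Qed.

(** On a list without repetitions [next] is a bijection of the whole type and the identity off the
    list; the permutation is the product of these maps, whose supports are disjoint. *)
Lemma cycles_perm (T : finType) (ls : seq (seq T)) : uniq (flatten ls) ->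
  exists s : {perm T},
    (forall x, x \notin flatten ls -> s x = x) /\
    (forall l x, l \in ls -> x \in l -> s x = next l x).
Proof.
elim: ls => [_|l ls IHls /=]; first by exists 1%g; split=> // x; rewrite perm1.
rewrite cat_uniq => /and3P[Ul dis /IHls[s [s_off s_on]]].
exists (perm (can_inj (prev_next Ul)) * s)%g.
have next_out x : x \notin l -> next l x = x.
  by move=> xl; rewrite next_nth (negPf xl).
have notin_ls x : x \in l -> x \notin flatten ls.
  by move=> xl; apply: contra dis => x_ls; apply/hasP; exists x.
split=> [x|l' x]; rewrite permM permE.
  by rewrite mem_cat negb_or => /andP[/next_out-> /s_off].
rewrite inE => /predU1P[->|l'ls] xl'; first by rewrite s_off // notin_ls ?mem_next.
have x_ls : x \in flatten ls by apply/flattenP; exists l'.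
rewrite next_out ?(s_on l') //.
by apply: contraL x_ls; apply: notin_ls.
Qed.

Section Paths.
Variables (V : finType) (D : rel V) (P : {set {set V}}).
Hypothesis smd : semicomplete_multipartite D P.

(** The arcs determine the partite sets. So the program can do without [P], and one output serves
    for every [P]. *)
Lemma same_part_nonadjacent u v : same_part P u v = nonadjacent D u v.
Proof.
case: smd => /and3P[/eqP coverP _ _] noarc arc.
have blockP x : exists2 A, A \in P & x \in A.
  by apply/bigcupP; rewrite -/(cover P) coverP inE.
apply/idP/idP => [/exists_inP[A AP /andP[uA vA]]|].
  by rewrite /nonadjacent !(noarc A).
case: (blockP u) (blockP v) => A AP uA [B BP vB].
have [eAB _|AB] := eqVneq A B.
  by apply/exists_inP; exists A => //; rewrite uA eAB vB.
by rewrite /nonadjacent -negb_or (arc _ _ _ _ AP BP).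
Qed.

(** An arc or a move inside a partite set: only pairs joined by nothing but the reverse arc are
    excluded. *)
Definition link u v := D u v || ~~ D v u.

Lemma link_part u v : same_part P u v -> link u v.
Proof. by rewrite same_part_nonadjacent /link => /andP[_ ->]; rewrite orbT. Qed.

Lemma link_path x s : path D x s -> path link x s.
Proof. by apply: sub_path => u v; rewrite /link => ->. Qed.

Lemma path_flatten x s ps : path D x s -> all (@dipath V D) ps ->
  path (linked P) (x :: s) ps -> path link x (s ++ flatten ps).
Proof.
elim: ps x s => [|[//|y t] ps IHps] x s xs /=; first by rewrite cats0 link_path.
move=> /andP[/andP[yt _] all_ps] /andP[xy y_ps].
by rewrite cat_path link_path //= link_part //= IHps.
Qed.

Lemma cycle_flatten ps : all (@dipath V D) ps -> path.cycle (linked P) ps ->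
  path.cycle link (flatten ps).
Proof.
case: ps => [//|[//|x s] ps] all_ps ps_cycle.
(* The first path is appended once more and the resulting walk is cut after its first vertex, which
   closes the cycle. *)
have all_ps' : all (@dipath V D) (rcons ps (x :: s)) by rewrite all_rcons.
have /andP[/andP[xs _] _] := all_ps.
have := path_flatten xs all_ps' ps_cycle.
by rewrite -cats1 flatten_cat /= catA cats0 -cat_rcons cat_path => /andP[].
Qed.

(** Successive paths are not assumed linked, so the move from one to the next may be an arc; hence
    an inequality. *)
Lemma paths_arcs_le ps x s : all (@dipath V D) ps -> flatten ps = x :: s ->
  paths_arcs ps <= consecutive_sum D x s.
Proof.
rewrite /paths_arcs.
elim: ps x s => [//|[//|y t] ps IHps] x s /= /andP[/andP[yt _] all_ps] [<- <-].
rewrite big_cons consecutive_sum_cat /path_arcs /= (consecutive_sum_path yt).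
rewrite leq_add2l; case def_ps: (flatten ps) => [|x' s'].
  case: ps all_ps def_ps {IHps} => [|[|//] ps] // _ _.
  by rewrite big_nil.
by apply: leq_trans (IHps _ _ all_ps def_ps) _; rewrite leq_addl.
Qed.

Lemma is_gpath_link ps : is_gpath D P ps ->
  exists x s, flatten ps = x :: s /\ path link x s.
Proof.
case/andP=> /and3P[]; case: ps => [//|[//|x s] ps] _ /= /andP[/andP[xs _] all_ps] _.
by move=> ps_path; exists x, (s ++ flatten ps); rewrite path_flatten.
Qed.

Lemma gpath_extend_arc qs q x : is_gpath D P (rcons qs q) ->
  D (last x q) x -> x \notin flatten (rcons qs q) ->
  is_gpath D P (rcons qs (rcons q x)).
Proof.
rewrite /is_gpath /disjoint_paths !all_rcons -!cats1 !flatten_cat /= !cats0.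
case: q => [|y t] /=; first by rewrite andbF.
move=> /andP[/and3P[_ /andP[/andP[yt Uy] ->] Uf] srt] tx xN.
have Uf' : uniq (flatten qs ++ y :: t ++ [:: x]).
  by rewrite -[y :: _]/((y :: t) ++ [:: x]) catA cats1 rcons_uniq xN.
have : uniq (y :: t ++ [:: x]) by move: Uf'; rewrite cat_uniq => /and3P[].
rewrite Uf' cat_path yt /= tx => -> /=; rewrite andbT.
apply/andP; split; first by case: (qs).
case: qs srt {Uf Uf' xN} => //= p qs; rewrite !cat_path /=.
by move=> /andP[-> /andP[]]; case: (last p qs) => //= ? ? ->.
Qed.

Lemma gpath_extend_part qs q x : is_gpath D P (rcons qs q) ->
  nonadjacent D (last x q) x -> x \notin flatten (rcons qs q) ->
  is_gpath D P (rcons (rcons qs q) [:: x]).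
Proof.
move=> /andP[/and3P[_ dps Uf] srt] qx xN.
apply/andP; split.
  rewrite /disjoint_paths all_rcons dps flatten_rcons cats1 rcons_uniq.
  by rewrite xN Uf andbT; case: (rcons qs q).
case: qs srt dps {Uf xN} => [|p qs] /=.
  by rewrite andbT; case: q qx => //= y t; rewrite same_part_nonadjacent => ->.
rewrite !rcons_path last_rcons all_rcons => -> /andP[_ /andP[dq _]] /=.
by case: q dq qx => //= y t _; rewrite same_part_nonadjacent => ->.
Qed.

End Paths.

(** * From G-paths and G-cycles to admissible permutations, and back *)

Section Apex.
Variables (V T : finType) (D : rel V) (P : {set {set V}}).
(** The points are abstract because two models occur: [option V] for the equality of the maxima, and
    the numbers up to n, with z = n, for the program. *)
Variables (z : T) (inj : V -> T).
Hypothesis smd : semicomplete_multipartite D P.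
Hypothesis inj_inj : injective inj.
Hypothesis inj_z : forall v, inj v != z.
Hypothesis inj_onto : forall x, x != z -> exists v, x = inj v.

Definition lift_arc x y :=
  [exists u, exists v, [&& x == inj u, y == inj v & D u v]].

Lemma lift_arc_inj u v : lift_arc (inj u) (inj v) = D u v.
Proof.
apply/existsP/idP => [[u' /existsP[v' /and3P[/eqP/inj_inj-> /eqP/inj_inj->]]]|uv] //.
by exists u; apply/existsP; exists v; rewrite !eqxx.
Qed.

Lemma lift_arc_apex x : ~~ lift_arc z x /\ ~~ lift_arc x z.
Proof.
split; apply/existsP => -[u /existsP[v /and3P[/eqP zu /eqP zv _]]].
  by have:= inj_z u; rewrite zu eqxx.
by have:= inj_z v; rewrite zv eqxx.
Qed.

Lemma lift_arc_irr x : ~~ lift_arc x x.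
Proof.
have [->|/inj_onto[v ->]] := eqVneq x z; first by case: (lift_arc_apex z).
rewrite lift_arc_inj; case: (smd) => /and3P[/eqP coverP _ _] noarc _.
have /bigcupP[A AP vA] : v \in cover P by rewrite coverP inE.
exact: (noarc A).
Qed.

Lemma lift_nonadjacent_inj u v :
  nonadjacent lift_arc (inj u) (inj v) = nonadjacent D u v.
Proof. by rewrite /nonadjacent !lift_arc_inj. Qed.

Lemma lift_nonadjacent_trans y x t : x != z -> y != z -> t != z ->
  nonadjacent lift_arc x y -> nonadjacent lift_arc y t ->
  nonadjacent lift_arc x t.
Proof.
move=> /inj_onto[u ->] /inj_onto[v ->] /inj_onto[w ->].
rewrite !lift_nonadjacent_inj -!(same_part_nonadjacent smd).
case/exists_inP=> A AP /andP[uA vA] /exists_inP[B BP /andP[vB wB]].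
apply/exists_inP; exists A => //; rewrite uA.
case: (smd) => /and3P[_ /trivIsetP tP _] _ _.
have [->//|AB] := eqVneq A B.
by have /disjointFr/(_ vA) := tP _ _ AP BP AB; rewrite vB.
Qed.

Local Notation adm := (admissible z lift_arc).

Lemma admissible_inj u v : adm (inj u) (inj v) = link D u v.
Proof. by rewrite /admissible !(negPf (inj_z _)) /= !lift_arc_inj. Qed.

Lemma admissible_apex v : adm z (inj v) && adm (inj v) z.
Proof. by rewrite /admissible !eqxx !(negPf (inj_z _)). Qed.

Lemma path_lift u s : path adm (inj u) (map inj s) = path (link D) u s.
Proof. by elim: s u => //= v s IHs u; rewrite IHs admissible_inj. Qed.

Lemma consecutive_sum_lift u s :
  consecutive_sum lift_arc (inj u) (map inj s) = consecutive_sum D u s.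
Proof. by elim: s u => //= v s IHs u; rewrite IHs lift_arc_inj. Qed.

Lemma gcycle_lift C : is_gcycle D P C ->
  let c := map inj (gcycle_vertices C) in
  path.cycle adm c /\
  (uniq c -> gcycle_arcs C <= \sum_(x <- c) lift_arc x (next c x)).
Proof.
have cycle_lift u s : path.cycle adm (map inj (u :: s)) = path.cycle (link D) (u :: s).
  by rewrite /= -map_rcons path_lift.
case: C => [[|u s]|ps] //= => [/and3P[_ us _]|].
  rewrite -[path _ _ _]/(path.cycle adm (map inj (u :: s))) cycle_lift /=.
  rewrite (link_path us); split=> // Ui.
  rewrite (@consecutive_sum_next T (fun x y => lift_arc x y)) // -map_rcons consecutive_sum_lift.
  by rewrite (consecutive_sum_path us) size_rcons.
move=> /andP[/and3P[ps0 dps _] cyc].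
have := cycle_flatten smd dps cyc.
case def_ps: (flatten ps) => [|u s].
  by case: ps {cyc} ps0 dps def_ps => [//|[//|]].
rewrite -cycle_lift => ->; split=> // Ui.
rewrite /= (@consecutive_sum_next T (fun x y => lift_arc x y)) // -map_rcons consecutive_sum_lift.
apply: leq_trans (paths_arcs_le dps def_ps) _.
by rewrite -cats1 consecutive_sum_cat leq_addr.
Qed.

Lemma gpath_lift ps : is_gpath D P ps ->
  let c := z :: map inj (flatten ps) in
  path.cycle adm c /\
  (uniq c -> paths_arcs ps <= \sum_(x <- c) lift_arc x (next c x)).
Proof.
move=> /[dup] /andP[/and3P[_ dps _] _] /(is_gpath_link smd)[u [s [def_ps us]]].
rewrite def_ps; split.
  rewrite /= rcons_path path_lift us last_map.
  by have [/andP[-> _] /andP[_ ->]] := (admissible_apex u, admissible_apex (last u s)).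
move=> Uc; rewrite (@consecutive_sum_next T (fun x y => lift_arc x y)) //.
apply: leq_trans (paths_arcs_le dps def_ps) _.
rewrite /= -cats1 consecutive_sum_cat consecutive_sum_lift.
by rewrite addnCA leq_addr.
Qed.

(** [gcycle] carries no decidable equality, so [all] takes the place of membership in a list of
    G-cycles. *)
Lemma all_mapP (A : Type) (B : eqType) (f : A -> B) (Q : pred A) r y :
  all Q r -> y \in map f r -> exists2 x, Q x & y = f x.
Proof.
elim: r => //= x r IHr /andP[Qx Qr]; rewrite inE => /predU1P[->|/(IHr Qr)//].
by exists x.
Qed.

Lemma gpath_gcycles_perm S : is_gpath_gcycles D P S ->
  exists s : {perm T}, admissible_perm z lift_arc s /\
                       gpath_gcycles_arcs S <= arc_count lift_arc s.
Proof.
case: S => ps Cs /and3P[/= gps all_Cs US].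
pose lsC := map (map inj \o @gcycle_vertices V) Cs.
pose ls := (z :: map inj (flatten ps)) :: lsC.
have flsC : flatten lsC = map inj (flatten (map (@gcycle_vertices V) Cs)).
  by rewrite map_flatten -map_comp.
have Uls : uniq (flatten ls).
  rewrite /ls /= flsC -map_cat map_inj_uniq // US andbT.
  by apply/mapP => -[v _ zv]; have:= inj_z v; rewrite -zv eqxx.
have [s [s_off s_on]] := cycles_perm Uls; exists s.
have [ps_cycle ps_arcs] := gpath_lift gps.
have Uin l : l \in ls -> uniq l.
  elim: ls Uls {s_off s_on} => //= l' ls' IHl; rewrite cat_uniq => /and3P[Ul _ Uls].
  by rewrite inE => /predU1P[->|/(IHl Uls)].
have cycle_in l : l \in ls -> path.cycle adm l.
  rewrite /ls inE => /predU1P[-> //|]; move=> /(all_mapP all_Cs)[C gC ->].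
  by have [] := gcycle_lift gC.
split.
  apply/forallP => x; case: (boolP (x \in flatten ls)) => [/flattenP[l l_ls xl]|xN].
    by rewrite (s_on l) // next_cycle // cycle_in.
  (* Vertices outside the G-path and the G-cycles are fixed, which is an admissible move. *)
  rewrite s_off //; have /inj_onto[v ->] : x != z.
    by apply: contraNneq xN => ->; rewrite mem_head.
  by rewrite admissible_inj /link orbN.
have -> : arc_count lift_arc s = \sum_x lift_arc x (s x) by [].
rewrite (bigID [in flatten ls]) -(big_uniq _ Uls).
apply: leq_trans (leq_addr _ _).
rewrite big_flatten /= /gpath_gcycles_arcs big_cons; apply: leq_add.
  have ls0 : z :: map inj (flatten ps) \in ls by apply: mem_head.
  apply: leq_trans (ps_arcs (Uin _ ls0)) _.
  by rewrite !big_seq; apply: leq_sum => x xl; rewrite (s_on _ _ ls0).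
rewrite big_map.
have: {subset map (map inj \o @gcycle_vertices V) Cs <= ls}.
  by move=> l l_ls; rewrite inE l_ls orbT.
elim: (Cs) all_Cs => [|C Cs' IHCs]; first by rewrite !big_nil.
rewrite /= => /andP[gC all_Cs'] sub; rewrite !big_cons leq_add ?IHCs //; last first.
  by move=> l lCs; rewrite sub // inE lCs orbT.
have lsC0 : map inj (gcycle_vertices C) \in ls by rewrite sub ?mem_head.
have [_ /(_ (Uin _ lsC0))] := gcycle_lift gC.
move/leq_trans; apply; rewrite /= !big_seq.
by apply: leq_sum => x xl; rewrite (s_on _ _ lsC0).
Qed.

(** The first m points after z, read as a G-path. The term i = 0 of the sum is the move out of z,
    which is no arc. *)
Definition traces (s : {perm T}) m ps :=
  [/\ is_gpath D P ps, map inj (flatten ps) = traject s (s z) m &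
      paths_arcs ps = \sum_(i < m) lift_arc (iter i s z) (iter i.+1 s z)].

Lemma traces1 (s : {perm T}) v : s z = inj v -> traces s 1 [:: [:: v]].
Proof.
move=> szv; split; rewrite //= ?szv //.
rewrite /paths_arcs big_seq1 big_ord_recl big_ord0 /=.
by have [/negPf->] := lift_arc_apex (s z).
Qed.

Lemma paths_arcs_rcons ps (p : seq V) :
  paths_arcs (rcons ps p) = paths_arcs ps + path_arcs p.
Proof. by rewrite /paths_arcs -cats1 big_cat big_seq1. Qed.

Lemma iter_perm_neq (s : {perm T}) m m' : m < m' -> m' < forder s z ->
  iter m' s z != iter m s z.
Proof.
move=> mm' m'z; apply: iter_neq_findex => //.
by rewrite findex_iter ?gtn_eqF // (ltn_trans mm').
Qed.

(** An admissible move between vertices that is no arc stays in a partite set, so v either prolongs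
    the last path or starts a new one. The list is explicit because the program makes the same
    choice. *)
Lemma traces_step (s : {perm T}) m qs q v (u := last v q) :
  admissible_perm z lift_arc s -> m.+2 < forder s z ->
  traces s m.+1 (rcons qs q) -> iter m.+2 s z = inj v ->
  [/\ inj u = iter m.+1 s z &
      traces s m.+2 (if D u v then rcons qs (rcons q v)
                     else rcons (rcons qs q) [:: v])].
Proof.
move=> /forallP adm_s mz [gps vs arcs] sv.
have q0 : q != [::].
  by case/andP: gps => /and3P[_]; rewrite all_rcons; case: (q).
have lastq : last (head v q) q = u by rewrite /u; case: (q) q0.
have vs_last : inj u = iter m.+1 s z.
  move: vs; rewrite flatten_rcons map_cat => /(congr1 (last z)).
  rewrite last_cat -lastq; case: (q) q0 => //= y t _.
  by rewrite last_map last_traject -iterSr.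
have trS : traject s (s z) m.+2 = rcons (traject s (s z) m.+1) (inj v).
  by rewrite trajectSr -iterSr sv.
have vN : v \notin flatten (rcons qs q).
  rewrite -(mem_map inj_inj) vs; apply/trajectP => -[j jm].
  rewrite -iterSr -sv => /eqP; apply/negP; apply: iter_perm_neq => //.
split=> //.
have sum_step : \sum_(i < m.+2) lift_arc (iter i s z) (iter i.+1 s z) =
    paths_arcs (rcons qs q) + D u v.
  by rewrite big_ord_recr /= -/(iter m.+2 s z) sv -/(iter m.+1 s z) -vs_last lift_arc_inj arcs.
have := adm_s (inj u); rewrite {2}vs_last -iterS sv admissible_inj => uv.
have arcs_eq : consecutive_sum D u [:: v] = D u v by rewrite /= addn0.
case: ifP => Duv; split.
- exact: gpath_extend_arc.
- by rewrite trS -vs !flatten_rcons -cats1 catA !map_cat cats1.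
- rewrite sum_step Duv !paths_arcs_rcons /path_arcs size_rcons -addnA.
  by case: (q) q0 => //= *; rewrite addn1.
- apply: gpath_extend_part => //; move: uv; rewrite /link Duv /=.
  by rewrite /nonadjacent Duv.
- by rewrite trS -vs !flatten_rcons -!cats1 !map_cat.
- by rewrite sum_step Duv paths_arcs_rcons /path_arcs /=.
Qed.

Lemma full_cycle (s : {perm T}) x : forder s z = #|T| -> fconnect s z x.
Proof.
move=> full; have /subset_cardP : #|fconnect s z| = #|T| by [].
by move=> /(_ (subset_predT _) x); rewrite inE.
Qed.

Lemma arc_count_full (s : {perm T}) : forder s z = #|T| ->
  arc_count lift_arc s =
    \sum_(i < #|T|.-1) lift_arc (iter i s z) (iter i.+1 s z).
Proof.
move=> full; rewrite /arc_count.
have -> : \sum_x lift_arc x (s x) = \sum_(x <- orbit s z) lift_arc x (s x).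
  rewrite (big_uniq _ (orbit_uniq s z)) /=; apply: eq_bigl => x.
  by rewrite -fconnect_orbit full_cycle.
have T0 : 0 < #|T| by rewrite -full fingraph.order_gt0.
rewrite (big_nth z) size_orbit full -(prednK T0) big_mkord big_ord_recr /=.
have ith m : m < #|T| -> nth z (orbit s z) m = iter m s z.
  by move=> mT; rewrite nth_traject ?full.
rewrite ith ?prednK // -iterS prednK // -full iter_order; last exact: perm_inj.
have [_ /negPf->] := lift_arc_apex (iter (forder s z).-1 s z).
rewrite addn0; apply: eq_bigr => i _; rewrite ith // (leq_trans (ltn_ord i)) //.
by rewrite full leq_pred.
Qed.

Lemma traces_full (s : {perm T}) ps : forder s z = #|T| ->
  traces s #|T|.-1 ps -> is_gpath D P ps /\ paths_arcs ps = arc_count lift_arc s.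
Proof. by move=> full [gps _ ->]; rewrite arc_count_full. Qed.

Lemma traces_exist (s : {perm T}) m : admissible_perm z lift_arc s ->
  m.+1 < forder s z -> exists ps, traces s m.+1 ps.
Proof.
move=> adm_s; elim: m => [|m IHm] mz.
  have /inj_onto[v szv] : s z != z by apply: (@iter_perm_neq _ 0 1).
  by exists [:: [:: v]]; apply: traces1.
have [ps] := IHm (ltnW mz).
case/lastP: ps => [[/andP[/and3P[]]]//|qs q tr].
have /inj_onto[v sv] : iter m.+2 s z != z by apply: (@iter_perm_neq _ 0 m.+2).
by have [_ tr'] := traces_step adm_s mz tr sv; eexists; exact: tr'.
Qed.

Lemma hamiltonian_gpath (s : {perm T}) : 1 < #|T| ->
  admissible_perm z lift_arc s -> forder s z = #|T| ->
  exists2 ps, is_gpath D P ps & paths_arcs ps = arc_count lift_arc s.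
Proof.
move=> T1 adm_s full.
have [|ps] := @traces_exist s #|T|.-2 adm_s.
  by rewrite full; case: #|T| T1 => [|[]].
have -> : #|T|.-2.+1 = #|T|.-1 by case: #|T| T1 => [|[]].
by move/(traces_full full) => [gps ?]; exists ps.
Qed.

Lemma is_gpath_gpath_gcycles ps : is_gpath D P ps ->
  is_gpath_gcycles D P (ps, [::]).
Proof.
move=> gps; rewrite /is_gpath_gcycles gps /= cats0.
by case/andP: gps => /and3P[].
Qed.

(** The identity will not do, as z -> z is inadmissible; a one-vertex G-path yields a permutation
    that moves z. *)
Lemma admissible_perm_exists : 0 < #|V| -> exists s, admissible_perm z lift_arc s.
Proof.
case/card_gt0P=> v _.
have /is_gpath_gpath_gcycles/gpath_gcycles_perm[s [adm_s _]] : is_gpath D P [:: [:: v]].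
  by [].
by exists s.
Qed.

Definition optimal (s : {perm T}) :=
  admissible_perm z lift_arc s /\
  forall s' : {perm T}, admissible_perm z lift_arc s' ->
    arc_count lift_arc s' <= arc_count lift_arc s.

Lemma optimal_merge (s : {perm T}) : optimal s -> forder s z < #|T| ->
  exists a b c d : T, optimal (rotate s a b c d) /\
    forder s z < forder (rotate s a b c d) z.
Proof.
move=> [adm_s max_s] /(merge_cycle lift_arc_apex lift_arc_irr lift_nonadjacent_trans adm_s).
move=> /existsP[a /existsP[b /existsP[c /existsP[d /and3P[adm' le' lt']]]]].
exists a, b, c, d; split=> //; split=> // s' /max_s /leq_trans; exact.
Qed.

Lemma optimal_hamiltonian : 0 < #|V| ->
  exists2 s, optimal s & forder s z = #|T|.
Proof.
move=> /admissible_perm_exists[s0 adm_s0].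
case: (@arg_maxnP _ s0 (admissible_perm z lift_arc) (arc_count lift_arc) adm_s0).
move=> s1 adm_s1 max_s1; have: optimal s1 by [].
(* Induction on the number of points missed by the cycle through z. *)
have [m] := ubnP (#|T| - forder s1 z).
elim: m s1 {adm_s1 max_s1} => // m IHm s1 le_m opt_s1.
have [full|nfull] := leqP #|T| (forder s1 z).
  by exists s1 => //; apply/eqP; rewrite eqn_leq full max_card.
have [a [b [c [d [opt' lt']]]]] := optimal_merge opt_s1 nfull.
by apply: IHm opt'; lia.
Qed.

Lemma gpath_le_optimal s ps : optimal s -> is_gpath D P ps ->
  paths_arcs ps <= arc_count lift_arc s.
Proof.
move=> [_ max_s] /is_gpath_gpath_gcycles/gpath_gcycles_perm[s' [/max_s le_s' le_ps]].
apply: leq_trans le_s'; apply: leq_trans le_ps.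
by rewrite /gpath_gcycles_arcs /= big_nil addn0.
Qed.
End Apex.

(** Both maxima are the arc count of an optimal permutation: every collection lifts to an admissible
    permutation with at least as many arcs, and an optimal single cycle reads back as a G-path. *)
Lemma gpath_gcycles_maximum (V : finType) (D : rel V) (P : {set {set V}}) :
  0 < #|V| -> semicomplete_multipartite D P ->
  exists m : nat,
    is_maximum (fun ps : seq (seq V) => is_gpath D P ps) (@paths_arcs V) m /\
    is_maximum (fun S : seq (seq V) * seq (gcycle V) => is_gpath_gcycles D P S)
               (@gpath_gcycles_arcs V) m.
Proof.
move=> V0 smd; pose inj (v : V) := Some v.
have inj_inj : injective inj by move=> u v [].
have inj_z v : inj v != None by [].
have inj_onto x : x != None -> exists v, x = inj v by case: x => // v _; exists v.
have [s opt full] := optimal_hamiltonian smd inj_inj inj_z inj_onto V0.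
have T1 : 1 < #|{: option V}| by rewrite card_option ltnS.
have [ps gps arcs] := hamiltonian_gpath smd inj_inj inj_z inj_onto T1 opt.1 full.
exists (arc_count (lift_arc D inj) s); split; split.
- by exists ps.
- by move=> qs; apply: gpath_le_optimal.
- exists (ps, [::]); first exact: is_gpath_gpath_gcycles.
  by rewrite /gpath_gcycles_arcs /= big_nil addn0.
- move=> S /(gpath_gcycles_perm smd inj_inj inj_z inj_onto)[s' [/opt.2 le_s' le_S]].
  exact: leq_trans le_S le_s'.
Qed.

(** * Bounded loops *)

(* The only loop, [PFor x c], runs x through 0, ..., n, where n is register 0:
   programs have a total semantics and a polynomial running time. *)
Inductive prog : Type :=
  | PSkip
  | PReg of nat & expr
  | PArr of nat & expr & expr
  | PSeq of prog & prog
  | PIf of expr & prog & prog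
  | PFor of nat & prog.

Fixpoint compile (c : prog) : cmd :=
  match c with
  | PSkip => Skip
  | PReg x e => SetReg x e
  | PArr a i e => SetArr a i e
  | PSeq c1 c2 => Seq (compile c1) (compile c2)
  | PIf e c1 c2 => If e (compile c1) (compile c2)
  | PFor x c =>
      Seq (SetReg x (Defs.Num 0))
          (While (Lt (Reg x) (Add (Reg 0) (Defs.Num 1)))
                 (Seq (compile c) (SetReg x (Add (Reg x) (Defs.Num 1)))))
  end.

Fixpoint den (c : prog) (s : state) : state :=
  match c with
  | PSkip => s
  | PReg x e => set_reg s x (eval s e)
  | PArr a i e => set_arr s a (eval s i) (eval s e)
  | PSeq c1 c2 => den c2 (den c1 s)
  | PIf e c1 c2 => if eval s e != 0 then den c1 s else den c2 s
  | PFor x c =>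
      iter (reg s 0).+1
           (fun s0 => let s1 := den c s0 in set_reg s1 x (reg s1 x + 1))
           (set_reg s x 0)
  end.

Fixpoint written_regs (c : prog) : seq nat :=
  match c with
  | PReg x _ => [:: x]
  | PSeq c1 c2 | PIf _ c1 c2 => written_regs c1 ++ written_regs c2
  | PFor x c => x :: written_regs c
  | _ => [::]
  end.

Fixpoint written_arrs (c : prog) : seq nat :=
  match c with
  | PArr a _ _ => [:: a]
  | PSeq c1 c2 | PIf _ c1 c2 => written_arrs c1 ++ written_arrs c2
  | PFor _ c => written_arrs c
  | _ => [::]
  end.

(** A loop body changes neither n nor the counter of its loop, so the compiled [While] runs exactly
    n.+1 times, as in [den]. *)
Fixpoint well_formed (c : prog) : bool :=
  match c with
  | PReg x _ => x != 0
  | PSeq c1 c2 | PIf _ c1 c2 => well_formed c1 && well_formed c2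
  | PFor x c => [&& x != 0, x \notin written_regs c & well_formed c]
  | _ => true
  end.

(** An upper bound: a conditional is charged for both branches. Each round of a loop adds an
    increment and a test; the final 2 pays for the initialisation and the failing test. *)
Fixpoint cost (c : prog) (n : nat) : nat :=
  match c with
  | PSeq c1 c2 => cost c1 n + cost c2 n
  | PIf _ c1 c2 => (cost c1 n + cost c2 n).+1
  | PFor _ c => n.+1 * (cost c n).+2 + 2
  | _ => 1
  end.

Lemma den_seq c1 c2 s : den (PSeq c1 c2) s = den c2 (den c1 s).
Proof. by []. Qed.

Lemma den_if e c1 c2 s :
  den (PIf e c1 c2) s = if eval s e != 0 then den c1 s else den c2 s.
Proof. by []. Qed.

Lemma reg_den c s y : y \notin written_regs c -> reg (den c s) y = reg s y.
Proof.
elim: c s => // [x e|c1 IH1 c2 IH2|e c1 IH1 c2 IH2|x c IHc] s /=.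
- by rewrite inE => /negPf->.
- by rewrite mem_cat negb_or => /andP[y1 y2]; rewrite IH2 ?IH1.
- by rewrite mem_cat negb_or => /andP[y1 y2]; case: ifP; rewrite ?IH2 ?IH1.
- rewrite inE negb_or => /andP[/negPf yx yc]; rewrite yx IHc //.
  by elim: (reg s 0) => /= [|m IHm]; rewrite yx ?IHc.
Qed.

Lemma arr_den c s a i : a \notin written_arrs c -> arr (den c s) a i = arr s a i.
Proof.
elim: c s => //= [b j e|c1 IH1 c2 IH2|e c1 IH1 c2 IH2|x c IHc] s.
- by rewrite inE => /negPf->.
- by rewrite mem_cat negb_or => /andP[y1 y2]; rewrite IH2 ?IH1.
- by rewrite mem_cat negb_or => /andP[y1 y2]; case: ifP; rewrite ?IH2 ?IH1.
- by move=> ac; rewrite IHc //; elim: (reg s 0) => //= m IHm; rewrite IHc.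
Qed.

Lemma well_formed_size c : well_formed c -> 0 \notin written_regs c.
Proof.
elim: c => //= [x _|c1 IH1 c2 IH2|_ c1 IH1 c2 IH2|x c IHc].
- by rewrite inE eq_sym.
- by rewrite mem_cat negb_or => /andP[/IH1-> /IH2].
- by rewrite mem_cat negb_or => /andP[/IH1-> /IH2].
- by move=> /and3P[x0 _ /IHc]; rewrite inE negb_or eq_sym x0.
Qed.

Lemma for_rule (I : nat -> state -> Prop) n x c s :
  well_formed (PFor x c) -> reg s 0 = n -> I 0 (set_reg s x 0) ->
  (forall i s', i <= n -> reg s' 0 = n -> reg s' x = i -> I i s' ->
     I i.+1 (set_reg (den c s') x i.+1)) ->
  I n.+1 (den (PFor x c) s).
Proof.
move=> /and3P[x0 xc /well_formed_size c0] s0 I0 IS; rewrite eq_sym in x0.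
pose step s0 := set_reg (den c s0) x (reg (den c s0) x + 1).
have H m : m <= n.+1 -> let s' := iter m step (set_reg s x 0) in
    [/\ reg s' 0 = n, reg s' x = m & I m s'].
  elim: m => [|m IHm] mn /=; first by rewrite eqxx (negPf x0).
  have [r0 rx Im] := IHm (ltnW mn); set s' := iter m _ _ in r0 rx Im *.
  rewrite /step /= eqxx (negPf x0) reg_den // r0 reg_den // rx addn1; split=> //.
  exact: IS.
have -> : den (PFor x c) s = iter n.+1 step (set_reg s x 0) by rewrite -s0.
by have [] := H n.+1 (leqnn _).
Qed.

Lemma compile_exec c n s : well_formed c -> reg s 0 = n ->
  exists2 t, exec (compile c) s t (den c s) & t <= cost c n.
Proof.
elim: c s => /= [|x e|a i e|c1 IH1 c2 IH2|e c1 IH1 c2 IH2|x c IHc] s.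
- by exists 1; first exact: ExecSkip.
- by exists 1; first exact: ExecSetReg.
- by exists 1; first exact: ExecSetArr.
- move=> /andP[wf1 wf2] s0; have [t1 e1 le1] := IH1 _ wf1 s0.
  have [|t2 e2 le2] := IH2 (den c1 s) wf2; first by rewrite reg_den // well_formed_size.
  by exists (t1 + t2); [apply: ExecSeq e1 e2 | rewrite leq_add].
- move=> /andP[wf1 wf2] s0; case: ifP => [e1|/negbFE/eqP e0].
    have [t1 ex1 le1] := IH1 _ wf1 s0.
    by exists t1.+1; [apply: ExecIfTrue | rewrite ltnS (leq_trans le1) ?leq_addr].
  have [t2 ex2 le2] := IH2 _ wf2 s0.
  by exists t2.+1; [apply: ExecIfFalse | rewrite ltnS (leq_trans le2) ?leq_addl].
- move=> /and3P[x0 xc wfc] s0; have c0 := well_formed_size wfc.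
  rewrite eq_sym in x0.
  set body := fun s0 : state => _.
  pose w := While (Lt (Reg x) (Add (Reg 0) (Defs.Num 1)))
                  (Seq (compile c) (SetReg x (Add (Reg x) (Defs.Num 1)))).
  (* m is the number of rounds still to come. *)
  have loop m s' : reg s' 0 = n -> reg s' x + m = n.+1 ->
      exists2 t, exec w s' t (iter m body s') & t <= m * (cost c n).+2 + 1.
    elim: m s' => [|m IHm] s' r0 rx.
      by exists 1 => //; apply: ExecWhileFalse; rewrite /= r0 addn1 -rx addn0 ltnn.
    have [t1 ex1 le1] := IHc _ wfc r0.
    have ex2 : exec (Seq (compile c) (SetReg x (Add (Reg x) (Defs.Num 1)))) s'
                    (t1 + 1) (body s').
      by apply: ExecSeq ex1 _; apply: ExecSetReg.
    have r0' : reg (body s') 0 = n by rewrite /body /= (negPf x0) reg_den.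
    have [|t2 ex3 le3] := IHm _ r0'.
      by rewrite /body /= eqxx reg_den // -rx addn1 addSnnS.
    exists ((t1 + 1) + t2).+1.
      rewrite iterSr; apply: ExecWhileTrue ex2 ex3.
      by rewrite /= r0 addn1 -rx -{1}[reg s' x]addn0 ltn_add2l.
    by rewrite mulSn; lia.
  have rs : reg (set_reg s x 0) 0 = n by rewrite /= (negPf x0).
  have [|t ext let_] := loop n.+1 _ rs; first by rewrite /= eqxx.
  exists (1 + t); last by lia.
  by apply: ExecSeq; [apply: ExecSetReg | rewrite s0; apply: ext].
Qed.

(** Powers of n.+1 do not decrease with the exponent, even at n = 0, so bounds of this form are
    closed under sums. *)
Lemma cost_polynomial c : exists C k, forall n, cost c n <= C * n.+1 ^ k.
Proof.
have add (f g : nat -> nat) : (exists C k, forall n, f n <= C * n.+1 ^ k) ->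
    (exists C k, forall n, g n <= C * n.+1 ^ k) ->
    exists C k, forall n, f n + g n <= C * n.+1 ^ k.
  move=> [C1 [k1 H1]] [C2 [k2 H2]]; exists (C1 + C2), (k1 + k2) => n.
  rewrite mulnDl leq_add // ?(leq_trans (H1 n)) ?(leq_trans (H2 n)) //.
    by rewrite leq_mul2l leq_pexp2l ?leq_addr ?orbT.
  by rewrite leq_mul2l leq_pexp2l ?leq_addl ?orbT.
have const m : exists C k, forall n, m <= C * n.+1 ^ k.
  by exists m, 0 => n; rewrite expn0 muln1.
elim: c => /= [|x e|a i e|c1 IH1 c2 IH2|e c1 IH1 c2 IH2|x c IHc]; try exact: const.
- exact: add.
- have [C [k H]] := add _ _ (const 1) (add _ _ IH1 IH2).
  by exists C, k => n; rewrite -add1n.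
- have [C [k H]] := add _ _ (const 2) IHc.
  apply: add; last exact: const.
  exists C, k.+1 => n; rewrite expnS mulnCA leq_mul2l orFb.
  exact: H.
Qed.

Lemma paths_found_by (inst : forall n : nat, rel 'I_n -> Prop)
    (sol : forall n : nat, rel 'I_n -> seq (seq 'I_n) -> Prop) (c : prog) :
  well_formed c ->
  (forall n (D : rel 'I_n), inst n D -> 0 < n /\
     exists2 ps, outputs_paths (den c (input_digraph D)) ps & sol n D ps) ->
  paths_found_in_polytime inst sol.
Proof.
move=> wfc correct; have [C [k cost_le]] := cost_polynomial c.
(* n.+1 is at most 2 n for positive n, whence the factor 2 ^ k. *)
exists (compile c), (C * 2 ^ k), k => n D /correct[n0 [ps out sol_ps]].
have [|t ex_t le_t] := @compile_exec c n (input_digraph D) wfc; first by [].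
exists t, (den c (input_digraph D)), ps; split=> //.
apply: leq_trans (leq_addr _ _); apply: leq_trans (leq_trans le_t (cost_le n)) _.
rewrite -mulnA -expnMn leq_mul2l; apply/orP; right.
by case: (k) => // k'; rewrite leq_exp2r //; lia.
Qed.

(* K is an invariant, L the goal, which the iteration x = i0 achieves. *)
Lemma for_reach (K L : state -> Prop) n x c s i0 :
  well_formed (PFor x c) -> reg s 0 = n -> i0 <= n ->
  (forall s' m, K s' -> K (set_reg s' x m)) ->
  (forall s' m, L s' -> L (set_reg s' x m)) ->
  (forall s', reg s' 0 = n -> reg s' x <= n -> K s' -> K (den c s')) ->
  (forall s', reg s' 0 = n -> reg s' x <= n -> L s' -> L (den c s')) ->
  (forall s', reg s' 0 = n -> reg s' x = i0 -> K s' -> L (den c s')) ->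
  K s -> L (den (PFor x c) s).
Proof.
move=> wf s0 i0n Kset Lset Kc Lc hit Ks.
suff [_] : K (den (PFor x c) s) /\ (i0 < n.+1 -> L (den (PFor x c) s)).
  by apply; rewrite ltnS.
apply: (@for_rule (fun m s' => K s' /\ (i0 < m -> L s')) n) => //.
  by split=> //; apply: Kset.
move=> i s' i_n s'0 s'x [Ks' Ls']; split; first by apply: Kset; apply: Kc; rewrite ?s'x.
rewrite ltnS leq_eqVlt => /predU1P[e|lt_i]; apply: Lset.
  by apply: hit => //; rewrite s'x.
by apply: Lc; rewrite ?s'x //; apply: Ls'.
Qed.

Lemma for_preserved (K : state -> Prop) n x c s :
  well_formed (PFor x c) -> reg s 0 = n ->
  (forall s' m, K s' -> K (set_reg s' x m)) ->
  (forall s', reg s' 0 = n -> reg s' x <= n -> K s' -> K (den c s')) ->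
  K s -> K (den (PFor x c) s).
Proof. by move=> wf s0 Kset Kc Ks; apply: (@for_reach K K n _ _ _ 0); eauto. Qed.

(** Each enclosing loop multiplies the progress [d] by n.+1; five of them make n.+1 ^ 5 passes of
    the auction. *)
Lemma for_progress (J : nat -> state -> Prop) d n x c s m :
  well_formed (PFor x c) -> reg s 0 = n ->
  (forall s' m k, J m s' -> J m (set_reg s' x k)) ->
  (forall s' m, reg s' 0 = n -> J m s' -> J (m + d) (den c s')) ->
  J m s -> J (m + n.+1 * d) (den (PFor x c) s).
Proof.
move=> wf s0 Jset Jc Js.
apply: (@for_rule (fun k s' => J (m + k * d) s') n) => //.
  by rewrite mul0n addn0; apply: Jset.
by move=> i s' _ s'0 _ Js'; rewrite mulSnr addnA; apply: Jset; apply: Jc.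
Qed.

(** * Nested loops *)

Fixpoint nest (xs : seq nat) (c : prog) : prog :=
  if xs is x :: xs' then PFor x (nest xs' c) else c.

Definition loop_range (n : nat) (xs : seq nat) (s : state) :=
  forall x, x \in xs -> reg s x <= n.

(** [ys] collects the counters of the loops already entered: in the induction each counter passes
    from [xs] to [ys], and the body may rely on all of them being at most n. *)
Lemma nest_preserved (K : state -> Prop) n xs ys c s :
  well_formed (nest xs c) -> all (fun y => y \notin written_regs (nest xs c)) ys ->
  (forall s' x m, x \in xs -> K s' -> K (set_reg s' x m)) ->
  (forall s', reg s' 0 = n -> loop_range n (xs ++ ys) s' -> K s' -> K (den c s')) ->
  reg s 0 = n -> loop_range n ys s -> K s -> K (den (nest xs c) s).
Proof.
elim: xs ys s => [|x xs IHxs] ys s wf fresh Kset Kc s0 s_ys Ks; first exact: Kc.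
have /and3P[x0 xc wf'] := wf.
have ysE y : y \in ys -> y != x /\ y \notin written_regs (nest xs c).
  by move=> /(allP fresh) /=; rewrite inE negb_or => /andP.
suff [//] : K (den (PFor x (nest xs c)) s) /\ loop_range n ys (den (PFor x (nest xs c)) s).
apply: (@for_preserved (fun s => K s /\ loop_range n ys s) n) => //.
  move=> s' m [Ks' s'ys]; split; first by apply: Kset; rewrite ?mem_head.
  by move=> y yys; have [/negPf yx _] := ysE _ yys; rewrite /= yx; apply: s'ys.
move=> s' s'0 s'x [Ks' s'ys]; split; last first.
  by move=> y yys; have [_ yc] := ysE _ yys; rewrite reg_den //; apply: s'ys.
apply: (IHxs (x :: ys)) => //.
- by rewrite /= xc; apply/allP => y /ysE[].
- by move=> s'' y m yxs; apply: Kset; rewrite inE yxs orbT.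
- move=> s'' s''0 range; apply: Kc => // y yin; apply: range.
  by move: yin; rewrite !(mem_cat, inE) orbCA orbA.
- by move=> y; rewrite inE => /predU1P[->//|/s'ys].
Qed.

Lemma nest_reach (K L : state -> Prop) n (v : nat -> nat) xs ys c s :
  well_formed (nest xs c) -> all (fun y => y \notin written_regs (nest xs c)) ys ->
  all (fun x => v x <= n) (xs ++ ys) ->
  (forall s' x m, x \in xs -> K s' -> K (set_reg s' x m)) ->
  (forall s' x m, x \in xs -> L s' -> L (set_reg s' x m)) ->
  (forall s', reg s' 0 = n -> loop_range n (xs ++ ys) s' -> K s' -> K (den c s')) ->
  (forall s', reg s' 0 = n -> loop_range n (xs ++ ys) s' -> L s' -> L (den c s')) ->
  (forall s', reg s' 0 = n -> (forall x, x \in xs ++ ys -> reg s' x = v x) ->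
     K s' -> L (den c s')) ->
  reg s 0 = n -> (forall y, y \in ys -> reg s y = v y) -> K s ->
  L (den (nest xs c) s).
Proof.
elim: xs ys s => [|x xs IHxs] ys s wf fresh v_n Kset Lset Kc Lc hit s0 s_ys Ks.
  exact: hit.
have /and3P[x0 xc wf'] := wf.
have ysE y : y \in ys -> y != x /\ y \notin written_regs (nest xs c).
  by move=> /(allP fresh) /=; rewrite inE negb_or => /andP.
have /andP[vx_n v_n'] : (v x <= n) && all (fun x => v x <= n) (xs ++ ys) by [].
have fresh' : all (fun y => y \notin written_regs (nest xs c)) (x :: ys).
  by rewrite /= xc; apply/allP => y /ysE[].
have mem_xs y : (y \in x :: xs ++ ys) = (y \in xs ++ x :: ys).
  by rewrite !(mem_cat, inE) orbCA.
have nest_keep (M : state -> Prop) :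
    (forall s' x' m, x' \in x :: xs -> M s' -> M (set_reg s' x' m)) ->
    (forall s', reg s' 0 = n -> loop_range n (x :: xs ++ ys) s' -> M s' -> M (den c s')) ->
    forall s', reg s' 0 = n -> reg s' x <= n ->
      M s' /\ (forall y, y \in ys -> reg s' y = v y) ->
      M (den (nest xs c) s') /\ (forall y, y \in ys -> reg (den (nest xs c) s') y = v y).
  move=> Mset Mc s' s'0 s'x [Ms' s'ys]; split; last first.
    by move=> y yys; have [_ yc] := ysE _ yys; rewrite reg_den //; apply: s'ys.
  apply: (@nest_preserved M n xs (x :: ys)) => //.
  - by move=> s'' y m yxs; apply: Mset; rewrite inE yxs orbT.
  - by move=> s'' s''0 range; apply: Mc => // y yin; apply: range; rewrite -mem_xs.
  - move=> y; rewrite inE => /predU1P[->//|yys]; rewrite s'ys //.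
    by apply: (allP v_n'); rewrite mem_cat yys orbT.
have set_keep (M : state -> Prop) s' m :
    (forall s' x' m, x' \in x :: xs -> M s' -> M (set_reg s' x' m)) ->
    M s' /\ (forall y, y \in ys -> reg s' y = v y) ->
    M (set_reg s' x m) /\ (forall y, y \in ys -> reg (set_reg s' x m) y = v y).
  move=> Mset [Ms' s'ys]; split; first by apply: Mset; rewrite ?mem_head.
  by move=> y yys; have [/negPf yx _] := ysE _ yys; rewrite /= yx; apply: s'ys.
suff [//] : L (den (PFor x (nest xs c)) s) /\
  (forall y, y \in ys -> reg (den (PFor x (nest xs c)) s) y = v y).
apply: (@for_reach (fun s => K s /\ forall y, y \in ys -> reg s y = v y)
  (fun s => L s /\ forall y, y \in ys -> reg s y = v y) n _ _ _ (v x)) => //.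
- by move=> s' m; apply: set_keep.
- by move=> s' m; apply: set_keep.
- exact: nest_keep.
- exact: nest_keep.
move=> s' s'0 s'x [Ks' s'ys]; split; last first.
  by move=> y yys; have [_ yc] := ysE _ yys; rewrite reg_den //; apply: s'ys.
apply: (IHxs (x :: ys)) => //.
- apply/allP => y; rewrite -mem_xs inE => /predU1P[->//|]; exact: (allP v_n').
- by move=> s'' y m yxs; apply: Kset; rewrite inE yxs orbT.
- by move=> s'' y m yxs; apply: Lset; rewrite inE yxs orbT.
- by move=> s'' s''0 range; apply: Kc => // y yin; apply: range; rewrite -mem_xs.
- by move=> s'' s''0 range; apply: Lc => // y yin; apply: range; rewrite -mem_xs.
- by move=> s'' s''0 range; apply: hit => // y yin; apply: range; rewrite -mem_xs.
- by move=> y; rewrite inE => /predU1P[->//|/s'ys].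
Qed.

(** * The auction algorithm *)

Section Auction.
Variables (n B : nat) (W : nat -> nat -> nat).
Hypothesis W_le : forall i j, i <= n -> j <= n -> W i j <= B.

(* [a i] is the object of bidder i, or n.+1 if i has none, [p j] the price of
   object j; [assigned_best] is complementary slackness up to the bid
   increment 1. *)
Record auction_inv (a p : nat -> nat) : Prop := AuctionInv {
  assigned_le : forall i, i <= n -> a i <= n.+1;
  assigned_inj : forall i i', i <= n -> i' <= n -> a i <= n -> a i = a i' -> i = i';
  assigned_best : forall i j, i <= n -> j <= n -> a i <= n ->
    W i j + p (a i) <= W i (a i) + p j + 1;
  priced_assigned : forall j, j <= n -> 0 < p j -> exists2 i, i <= n & a i = j;
  price_le : forall j, j <= n -> p j <= B.+1 }.

(** Objects with a positive price have owners. If all had one, choosing owners would inject the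
    objects into equally many bidders, and no bidder would be unassigned. *)
Lemma auction_free a p i : auction_inv a p -> i <= n -> a i = n.+1 ->
  exists2 j, j <= n & p j = 0.
Proof.
move=> inv i_n ai.
case: (boolP [exists j : 'I_n.+1, p j == 0]) => [/existsP[j /eqP pj]|].
  by exists j => //; rewrite -ltnS.
rewrite negb_exists => /forallP all_priced.
have owned (j : 'I_n.+1) : exists k : 'I_n.+1, a k == j.
  have [||k k_n ak] := priced_assigned inv (j := j); first by rewrite -ltnS.
    by rewrite lt0n.
  by exists (Ordinal (k_n : k < n.+1)); apply/eqP.
pose f j := xchoose (owned j).
have af j : a (f j) = j by apply/eqP; apply: (xchooseP (owned j)).
have f_inj : injective f by move=> j j' e; apply: val_inj; rewrite /= -af e af.
have [g fg gf] := injF_bij f_inj.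
have := af (g (Ordinal (i_n : i < n.+1))); rewrite gf /= ai => e.
by have := ltn_ord (g (Ordinal (i_n : i < n.+1))); rewrite -e ltnn.
Qed.

(** Object b is best for bidder i, and remains so up to 1 after its price rises by 1. For the other
    bidders only an alternative becomes dearer, and a former owner of b is released. *)
Lemma auction_bid a p i b a' p' : auction_inv a p -> i <= n -> a i = n.+1 ->
  b <= n -> (forall j, j <= n -> W i j + p b <= W i b + p j) ->
  (forall k, k <= n ->
     a' k = if k == i then b else if a k == b then n.+1 else a k) ->
  (forall j, j <= n -> p' j = if j == b then (p b).+1 else p j) ->
  auction_inv a' p'.
Proof.
move=> inv i_n ai b_n best a'E p'E.
have p_p' j : j <= n -> p j <= p' j by move=> jn; rewrite p'E //; case: eqP => // ->.
split.
- move=> k kn; rewrite a'E //; case: ifP => _; first exact: leqW.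
  by case: ifP => _ //; apply: (assigned_le inv).
- move=> k k' kn k'n; rewrite !a'E //.
  case: (k =P i) => [->|ki]; case: (k' =P i) => [->|k'i] //; case: (a k =P b) => akb;
    case: (a k' =P b) => ak'b le_n e; try lia.
  exact: (assigned_inj inv).
- move=> k j kn jn; rewrite a'E //; case: (k =P i) => [->|ki] a'n.
    rewrite !p'E // eqxx; have := best j jn; case: eqP => [->|_]; lia.
  move: a'n; case: (a k =P b) => akb; first by rewrite ltnn.
  move=> akn; have := assigned_best inv kn jn akn; have := p_p' j jn.
  by rewrite (p'E (a k)) //; case: eqP => // _; lia.
- move=> j jn; rewrite p'E //; case: (j =P b) => [-> _|jb pj].
    by exists i => //; rewrite a'E // eqxx.
  have [k kn akj] := priced_assigned inv jn pj; exists k => //; rewrite a'E // akj.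
  case: (k =P i) => [ki|_]; last by case: eqP.
  by move: jn; rewrite -akj ki ai ltnn.
- move=> j jn; rewrite p'E //; case: eqP => // _; last exact: (price_le inv).
  (* While i is unassigned some object costs 0; b is at least as good, so its old price is at most
     [W i b], hence at most B. *)
  have [j0 j0n pj0] := auction_free inv i_n ai.
  have := best j0 j0n; have := W_le i_n b_n; rewrite pj0; lia.
Qed.

Lemma auction_bid_price p b p' : b <= n ->
  (forall j, j <= n -> p' j = if j == b then (p b).+1 else p j) ->
  \sum_(j < n.+1) p' j = (\sum_(j < n.+1) p j).+1.
Proof.
move=> bn p'E; pose b' : 'I_n.+1 := Ordinal (bn : b < n.+1).
rewrite (bigD1 b') // [in RHS](bigD1 b') //= p'E // eqxx addSn; congr (_ + _).+1.
apply: eq_bigr => j jb; rewrite p'E -1?ltnS //.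
by case: eqP => // e; case/eqP: jb; apply: val_inj.
Qed.

Lemma auction_price_bound a p : auction_inv a p ->
  \sum_(j < n.+1) p j <= n.+1 * B.+1.
Proof.
move=> inv; apply: (@leq_trans (\sum_(j < n.+1) B.+1)).
  by apply: leq_sum => j _; apply: (price_le inv); rewrite -ltnS.
by rewrite sum_nat_const card_ord.
Qed.

(** Slackness is summed over all bidders: the prices cancel, since s and t both run through all
    objects, and an error of 1 per bidder remains. *)
Lemma auction_final a p : auction_inv a p -> (forall i, i <= n -> a i <= n) ->
  exists2 s : {perm 'I_n.+1}, (forall i, a (val i) = s i) &
    forall t : {perm 'I_n.+1},
      \sum_i W (val i) (t i) <= \sum_i W (val i) (s i) + n.+1.
Proof.
move=> inv an.
have a_ord (i : 'I_n.+1) : a i < n.+1 by rewrite ltnS an // -ltnS.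
pose f i := Ordinal (a_ord i).
have f_inj : injective f.
  move=> i i' /(congr1 val) /= e; apply: val_inj.
  by apply: (assigned_inj inv) e; rewrite -ltnS.
exists (perm f_inj) => [i|t]; first by rewrite permE.
have reindex_p (r : {perm 'I_n.+1}) : \sum_i p (r i) = \sum_(i < n.+1) p i.
  by rewrite [RHS](reindex_inj (@perm_inj _ r)).
set s := perm f_inj.
suff: \sum_i (W (val i) (t i) + p (s i)) <= \sum_i (W (val i) (s i) + p (t i) + 1).
  rewrite !big_split /= !reindex_p sum_nat_const card_ord muln1.
  by rewrite addnAC leq_add2r.
apply: leq_sum => i _; rewrite permE /=.
have le_n (x : 'I_n.+1) : x <= n by rewrite -ltnS.
by have := assigned_best inv (le_n i) (le_n (t i)) (an _ (le_n i)); lia.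
Qed.

End Auction.

(** * Weights whose heaviest permutations are the optimal ones *)

Section Weight.
Variables (V T : finType) (D : rel V) (P : {set {set V}}).
Variables (z : T) (inj : V -> T).
Hypothesis smd : semicomplete_multipartite D P.
Hypothesis inj_inj : injective inj.
Hypothesis inj_z : forall v, inj v != z.
Hypothesis inj_onto : forall x, x != z -> exists v, x = inj v.

Local Notation arc := (lift_arc D inj).

(* #|T| is large enough for one inadmissible move to outweigh all arcs. *)
Definition weight (x y : T) : nat :=
  if admissible z arc x y then #|T| + arc x y else 0.

Lemma weight_le x y : weight x y <= #|T|.+1.
Proof. by rewrite /weight; case: ifP => // _; case: (arc x y); rewrite ?addn1 ?addn0. Qed.

Lemma weight_sum_admissible (s : {perm T}) : admissible_perm z arc s ->
  \sum_x weight x (s x) = #|T| * #|T| + arc_count arc s.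
Proof.
move=> /forallP adm_s; rewrite /arc_count -sum_nat_const -big_split /=.
by apply: eq_bigr => x _; rewrite /weight adm_s.
Qed.

Lemma weight_sum_inadmissible (s : {perm T}) : ~~ admissible_perm z arc s ->
  \sum_x weight x (s x) < #|T| * #|T|.
Proof.
rewrite negb_forall => /existsP[x xN].
have T0 : 0 < #|T| by apply/card_gt0P; exists x.
rewrite (bigD1 x) //= {1}/weight (negPf xN) add0n.
apply: (@leq_ltn_trans (\sum_(y | y != x) #|T|.+1)).
  by apply: leq_sum => y _; apply: weight_le.
(* With m + 1 points, the bound m (m + 2) is one less than the square of m + 1. *)
by rewrite sum_nat_const cardC1; case: #|T| T0 => // m _ /=; nia.
Qed.

Lemma weight_optimal (s : {perm T}) : 0 < #|V| ->
  (forall t : {perm T}, \sum_x weight x (t x) <= \sum_x weight x (s x)) ->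
  optimal D z inj s.
Proof.
move=> V_gt0 max_s.
have [t0 adm_t0] := admissible_perm_exists smd inj_inj inj_z inj_onto V_gt0.
have adm_s : admissible_perm z arc s.
  apply: contraT => /weight_sum_inadmissible; rewrite ltnNge => /negP[].
  by apply: leq_trans (max_s t0); rewrite weight_sum_admissible // leq_addr.
split=> // t adm_t; have := max_s t.
by rewrite !weight_sum_admissible // leq_add2l.
Qed.

(** With [weight_optimal], this lets the program judge a rotation by total weights, without testing
    admissibility. *)
Lemma optimal_weight (s t : {perm T}) : optimal D z inj s ->
  \sum_x weight x (t x) <= \sum_x weight x (s x).
Proof.
move=> [adm_s max_s]; rewrite (weight_sum_admissible adm_s).
have [adm_t|/weight_sum_inadmissible/ltnW le_t] := boolP (admissible_perm z arc t).
  by rewrite weight_sum_admissible // leq_add2l max_s.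
by apply: leq_trans le_t _; rewrite leq_addr.
Qed.

End Weight.

(** * The program *)

(* Vertices are 0, ..., n-1 and z is n.  There being no multiplication, the row
   offsets u * n.+1 and u * n of the weights and of the input matrix are
   tabulated in [aRow] and [aRowD].  [aSucc] holds the current permutation. *)
Local Notation "c1 ;; c2" := (PSeq c1 c2) (at level 95, right associativity).
Local Notation rSize := 0 (only parsing).
Local Notation rCount := 1 (only parsing).
Local Notation rScale := 2 (only parsing).
Local Notation rBase := 3 (only parsing).
Local Notation rRow := 4 (only parsing).
Local Notation rRowD := 5 (only parsing).
Local Notation rU := 6 (only parsing).
Local Notation rV := 7 (only parsing).
Local Notation rW := 8 (only parsing).
Local Notation aArc := 0 (only parsing).
Local Notation aLen := 1 (only parsing).
Local Notation aOut := 2 (only parsing).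
Local Notation aRow := 3 (only parsing).
Local Notation aRowD := 4 (only parsing).
Local Notation aWt := 5 (only parsing).
Local Notation aSucc := 6 (only parsing).
Local Notation aPrice := 7 (only parsing).
Local Notation aCand := 8 (only parsing).

Local Notation rI := 9 (only parsing).
Local Notation rJ := 10 (only parsing).
Local Notation rBest := 11 (only parsing).

Definition cell (u v : expr) : expr := Arr aWt (Add (Arr aRow u) v).
Definition unassigned : expr := Add (Reg rSize) (Defs.Num 1).

(** [rBase] grows by n + 2 in each of the n + 1 rounds and ends as the scaled weight of an
    admissible move that is no arc. *)
Definition init_row : prog :=
  PArr aRow (Reg rU) (Reg rRow);;
  PArr aRowD (Reg rU) (Reg rRowD);;
  PArr aSucc (Reg rU) unassigned;;
  PReg rRow (Add (Reg rRow) (Add (Reg rSize) (Defs.Num 1)));;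
  PReg rRowD (Add (Reg rRowD) (Reg rSize));;
  PReg rBase (Add (Reg rBase) (Reg rScale)).

Definition init_rows : prog :=
  PReg rScale (Add (Reg rSize) (Defs.Num 2));; PFor rU init_row.

(** The tests against n precede the look-up: the input matrix has width n, so column n would be the
    start of the next row. *)
Definition weight_uv : prog :=
  PReg rW (Reg rBase);;
  PIf (Lt (Reg rU) (Reg rSize))
    (PIf (Lt (Reg rV) (Reg rSize))
      (PIf (Arr aArc (Add (Arr aRowD (Reg rU)) (Reg rV)))
        (PReg rW (Add (Reg rBase) (Reg rScale)))
        (PIf (Arr aArc (Add (Arr aRowD (Reg rV)) (Reg rU)))
          (PReg rW (Defs.Num 0)) PSkip))
      PSkip)
    (PIf (Lt (Reg rV) (Reg rSize)) PSkip (PReg rW (Defs.Num 0))).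

Definition init_weight_uv : prog :=
  weight_uv;; PArr aWt (Add (Arr aRow (Reg rU)) (Reg rV)) (Reg rW).

Definition init_weights : prog := PFor rU (PFor rV init_weight_uv).

Definition best_step : prog :=
  PIf (Lt (Add (cell (Reg rI) (Reg rBest)) (Arr aPrice (Reg rJ)))
          (Add (cell (Reg rI) (Reg rJ)) (Arr aPrice (Reg rBest))))
    (PReg rBest (Reg rJ)) PSkip.

Definition best_object : prog := PReg rBest (Defs.Num 0);; PFor rJ best_step.

Definition release_step : prog :=
  PIf (Eq (Arr aSucc (Reg rJ)) (Reg rBest)) (PArr aSucc (Reg rJ) unassigned) PSkip.

Definition bid : prog :=
  best_object;; PFor rJ release_step;;
  PArr aSucc (Reg rI) (Reg rBest);;
  PArr aPrice (Reg rBest) (Add (Arr aPrice (Reg rBest)) (Defs.Num 1)).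

Definition bid_if_unassigned : prog :=
  PIf (Eq (Arr aSucc (Reg rI)) unassigned) bid PSkip.

Definition auction_pass : prog := PFor rI bid_if_unassigned.

(* n.+1 ^ 5 passes: each raises a price while some bidder is unassigned, and
   the prices are bounded by [weight_bound].+1. *)
Definition auction : prog :=
  PFor 12 (PFor 13 (PFor 14 (PFor 15 (PFor 16 auction_pass)))).

Lemma row_major_inj m a b c d : b < m -> d < m ->
  (a * m + b == c * m + d) = (a == c) && (b == d).
Proof.
move=> bm dm; apply/eqP/andP => [e|[/eqP-> /eqP->]] //.
have m0 : 0 < m by apply: leq_trans bm.
have := congr1 (divn^~ m) e; have := congr1 (modn^~ m) e.
rewrite /= !modnMDl !modn_small // => ->.
by rewrite !divnMDl // !divn_small // !addn0 => ->.
Qed.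

(** * Correctness of the tables and of the auction *)

Section Program.
Variables (n : nat) (D : rel 'I_n).

Definition embed : 'I_n -> 'I_n.+1 := widen_ord (leqnSn n).

Local Notation apex := (@ord_max n).
Local Notation arc := (lift_arc D embed).

(* The auction is optimal up to n.+1, hence exact on multiples of n.+2. *)
Definition scaled_weight (i j : nat) : nat :=
  n.+2 * weight D apex embed (inord i) (inord j).

Lemma input_arc (x y : 'I_n.+1) : x < n -> y < n ->
  arr (input_digraph D) aArc (x * n + y) = arc x y.
Proof.
move=> xn yn; rewrite /=; congr nat_of_bool.
apply: eq_existsb => u; apply: eq_existsb => v.
by rewrite row_major_inj // -andbA.
Qed.

Lemma weight_input (x y : 'I_n.+1) : n.+2 * weight D apex embed x y =
  if x < n then
    if y < n then
      if arr (input_digraph D) aArc (x * n + y) != 0 then n.+1 * n.+2 + n.+2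
      else if arr (input_digraph D) aArc (y * n + x) != 0 then 0
      else n.+1 * n.+2
    else n.+1 * n.+2
  else if y < n then n.+1 * n.+2 else 0.
Proof.
have maxE (x' : 'I_n.+1) : (x' == apex) = ~~ (x' < n).
  by rewrite -val_eqE /= -leqNgt eqn_leq -ltnS ltn_ord.
have apexN (x' y' : 'I_n.+1) : ~~ (x' < n) || ~~ (y' < n) -> arc x' y' = false.
  move=> out; apply/negbTE; apply: contraL out => /existsP[u /existsP[v]].
  by move=> /and3P[/eqP-> /eqP-> _] /=; rewrite !ltn_ord.
have := @input_arc x y; have := @input_arc y x.
rewrite /weight /admissible card_ord !maxE.
set a1 := arr _ _ _; set a2 := arr _ _ _ => a1E a2E.
case xn: (x < n); case yn: (y < n) => /=; last by rewrite muln0.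
- rewrite a1E // a2E //; case: (arc x y) => /=; first by rewrite mulnC addn1 mulSn addnC.
  by case: (arc y x) => /=; rewrite ?muln0 // addn0 mulnC.
- by rewrite apexN ?xn ?yn // addn0 mulnC.
- by rewrite apexN ?xn ?yn // addn0 mulnC.
Qed.

(** [rCount] and [aLen] are recorded because the output phase counts up from them without clearing
    them. *)
Definition initialized (s : state) : Prop :=
  [/\ reg s rScale = n.+2, reg s rBase = n.+1 * n.+2,
      forall u, u <= n -> arr s aRow u = u * n.+1 /\ arr s aRowD u = u * n,
      forall i, arr s aArc i = arr (input_digraph D) aArc i &
      (forall u, u <= n -> arr s aSucc u = n.+1) /\
      (forall u, u <= n -> arr s aPrice u = 0) /\
      (reg s rCount = 0 /\ forall i, arr s aLen i = 0)].

Lemma init_rowsP : initialized (den init_rows (input_digraph D)).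
Proof.
pose I m s := [/\ reg s rScale = n.+2 /\ reg s rBase = m * n.+2,
  reg s rRow = m * n.+1, reg s rRowD = m * n &
  forall u, u < m -> [/\ arr s aRow u = u * n.+1, arr s aRowD u = u * n &
        arr s aSucc u = n.+1]].
suff: I n.+1 (den init_rows (input_digraph D)).
  move=> [[rS rB] _ _ rows]; split=> // [u /rows[]//|i|].
    by rewrite arr_den.
  split=> [u /rows[]//|]; split=> [u _|]; first by rewrite arr_den.
  by rewrite reg_den //; split=> // i; rewrite arr_den.
rewrite /init_rows den_seq; apply: (@for_rule I n) => //.
  by rewrite /I /=; split; rewrite ?addn2.
move=> m s mn s0 sU; rewrite /I /= sU s0.
move=> [[-> ->] -> -> rows].
split; rewrite ?(mulSnr m) ?addn1 //.
move=> u; rewrite ltnS leq_eqVlt; case: eqP => [->//|_ /= um].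
exact: rows.
Qed.

Definition ready (s : state) : Prop :=
  reg s rSize = n /\
  forall i j, i <= n -> j <= n -> arr s aWt (arr s aRow i + j) = scaled_weight i j.

Lemma init_weight_uvP s u v : initialized s -> reg s rSize = n ->
  reg s rU = u -> reg s rV = v -> u <= n -> v <= n ->
  forall i j, i <= n -> j <= n ->
  arr (den init_weight_uv s) aWt (i * n.+1 + j) =
    if (i == u) && (j == v) then scaled_weight u v else arr s aWt (i * n.+1 + j).
Proof.
move=> [rS rB rows arcs _] s0 sU sV un vn i j i_n jn.
have wE : reg (den weight_uv s) rW = scaled_weight u v.
  rewrite /scaled_weight weight_input !inordK // -!arcs.
  have [_ rowu] := rows u un; have [_ rowv] := rows v vn.
  rewrite /weight_uv /= s0 sU sV rowu rowv rS rB.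
  by do ?[case: ifP => //=].
have rU' : reg (den weight_uv s) rU = u by rewrite reg_den.
have rV' : reg (den weight_uv s) rV = v by rewrite reg_den.
have arr' a i' : arr (den weight_uv s) a i' = arr s a i' by rewrite arr_den.
rewrite /init_weight_uv den_seq; move: (den _ _) wE rU' rV' arr' => s1 wE rU' rV' arr'.
rewrite /= wE rU' rV' !arr'.
by have [-> _] := rows u un; rewrite row_major_inj.
Qed.

Lemma initialized_den c s :
  [&& rScale \notin written_regs c, rBase \notin written_regs c,
      rCount \notin written_regs c &
      all (fun a => a \notin written_arrs c)
          [:: aArc; aLen; aRow; aRowD; aSucc; aPrice]] ->
  initialized s -> initialized (den c s).
Proof.
move=> /and4P[c2 c3 c1 /= /and5P[a0 a1 ar1 ar2 /and3P[a6 a7 _]]].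
move=> [r2 r3 rows arcs [succ [price [r1 len]]]].
split; rewrite ?reg_den //.
- by move=> u un; rewrite !arr_den //; apply: rows.
- by move=> i; rewrite arr_den.
split=> [u un|]; rewrite ?arr_den ?succ //.
split=> [u un|]; rewrite ?arr_den ?price //.
by split=> // i; rewrite arr_den.
Qed.

Lemma init_weightsP s : initialized s -> reg s rSize = n ->
  initialized (den init_weights s) /\ ready (den init_weights s).
Proof.
move=> ini s0.
have ini' : initialized (den init_weights s) by apply: initialized_den.
split=> //; split; first by rewrite reg_den.
pose I m s := initialized s /\ forall i j, i <= n -> j <= n -> i < m ->
  arr s aWt (i * n.+1 + j) = scaled_weight i j.
suff [_ H] : I n.+1 (den init_weights s).
  move=> i j i_n jn; have [_ _ rows _ _] := ini'.
  by have [-> _] := rows i i_n; apply: H.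
rewrite /init_weights; apply: (@for_rule I n) => //.
move=> u s1 un s1n sU [ini1 Iu].
pose J m s := [/\ initialized s, reg s rU = u & forall i j, i <= n -> j <= n ->
  (i < u) || (i == u) && (j < m) -> arr s aWt (i * n.+1 + j) = scaled_weight i j].
suff [ini2 _ H] : J n.+1 (den (PFor rV init_weight_uv) s1).
  split=> // i j i_n jn; rewrite ltnS leq_eqVlt orbC => iu.
  by apply: H; rewrite // ltnS jn andbT.
apply: (@for_rule J n) => //.
  by split=> // i j i_n jn; rewrite ltn0 andbF orbF; apply: Iu.
move=> v s2 vn s2n sV [ini2 s2U Jv].
have ini3 : initialized (den init_weight_uv s2) by apply: initialized_den.
have s3U : reg (den init_weight_uv s2) rU = u by rewrite reg_den.
have s3W := init_weight_uvP ini2 s2n s2U sV un vn.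
move: (den _ _) ini3 s3U s3W => s3 ini3 s3U s3W.
split=> // i j i_n jn lt_ij; rewrite /= s3W //.
case: andP => [[/eqP-> /eqP->]//|ne]; apply: Jv => //.
case/orP: lt_ij => [->//|/andP[iu]]; rewrite iu ltnS leq_eqVlt => /orP[jv|->].
  by case: ne.
by rewrite orbT.
Qed.

Lemma ready_frame s s' : ready s -> reg s' rSize = reg s rSize ->
  (forall i, arr s' aRow i = arr s aRow i) ->
  (forall i, arr s' aWt i = arr s aWt i) -> ready s'.
Proof.
by move=> [s0 W] s'0 row wt; split=> [|i j i_n jn]; rewrite ?s'0 // row wt W.
Qed.

Lemma ready_den c s :
  [&& rSize \notin written_regs c, aRow \notin written_arrs c &
      aWt \notin written_arrs c] -> ready s -> ready (den c s).
Proof.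
move=> /and3P[c0 c3 c5] rs; apply: ready_frame rs _ _ _ => *;
  by rewrite ?reg_den ?arr_den.
Qed.

Local Notation W := scaled_weight.

Lemma best_objectP s i : ready s -> reg s rI = i -> i <= n ->
  let b := reg (den best_object s) rBest in
  b <= n /\ forall j, j <= n ->
    W i j + arr s aPrice b <= W i b + arr s aPrice j.
Proof.
move=> rdy sI i_n; set p := arr s aPrice.
pose I m s' := [/\ ready s', reg s' rI = i, forall j, arr s' aPrice j = p j,
  reg s' rBest <= n & forall j, j < m ->
    W i j + p (reg s' rBest) <= W i (reg s' rBest) + p j].
suff [] : I n.+1 (den best_object s) by [].
have [s0 _] := rdy; rewrite /best_object den_seq; apply: (@for_rule I n) => //.
move=> m s' mn s'0 s'J [rdy' s'I s'p b_n best].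
have [_ wt] := rdy'.
rewrite /I /best_step /= !s'p s'J s'I !wt //.
case: ltnP => [lt|ge] /=; split=> //.
- move=> j; rewrite ltnS leq_eqVlt => /predU1P[->//|/best]; lia.
- by move=> j; rewrite ltnS leq_eqVlt => /predU1P[->//|/best].
Qed.

Lemma releaseP s b : reg s rSize = n -> reg s rBest = b -> forall k, k <= n ->
  arr (den (PFor rJ release_step) s) aSucc k =
    if arr s aSucc k == b then n.+1 else arr s aSucc k.
Proof.
move=> s0 sB; set a := arr s aSucc.
pose I m s' := reg s' rBest = b /\ forall k,
  arr s' aSucc k = if (k < m) && (a k == b) then n.+1 else a k.
suff [_ H] : I n.+1 (den (PFor rJ release_step) s).
  by move=> k kn; rewrite H ltnS kn.
apply: (@for_rule I n) => //.
move=> m s' mn s'0 s'J [s'B s'a].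
rewrite /I /release_step /= s'B s'J s'0 s'a ltnn /=.
case: (a m =P b) => am /=; split=> // k; rewrite s'a.
  case: (k =P m) => [->|km]; first by rewrite leqnn am eqxx addn1.
  by rewrite [in RHS]ltnS [k <= m]leq_eqVlt; case: (k =P m).
by rewrite [in RHS]ltnS [k <= m]leq_eqVlt; case: (k =P m) => [->|] //=; rewrite ltnn; case: eqP.
Qed.

Definition weight_bound : nat := n.+2 * n.+2.

Lemma scaled_weight_le i j : W i j <= weight_bound.
Proof.
rewrite /scaled_weight leq_mul2l /=; apply: leq_trans (weight_le _ _ _ _ _) _.
by rewrite card_ord.
Qed.

Definition auction_state s :=
  ready s /\ auction_inv n weight_bound W (arr s aSucc) (arr s aPrice).

Definition price_sum s := \sum_(j < n.+1) arr s aPrice j.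

Lemma bidP s : auction_state s -> reg s rI <= n -> arr s aSucc (reg s rI) = n.+1 ->
  auction_state (den bid s) /\ price_sum (den bid s) = (price_sum s).+1.
Proof.
move=> [rdy inv] i_n ai; set i := reg s rI in i_n ai.
have [b_n best] := best_objectP rdy (erefl i) i_n.
have rdy' : ready (den bid s) by apply: ready_den.
set b := reg _ _ in b_n best.
set s1 := den best_object s.
have [s10 s1a s1p s1I] : [/\ reg s1 rSize = n,
   forall k, arr s1 aSucc k = arr s aSucc k,
   forall k, arr s1 aPrice k = arr s aPrice k & reg s1 rI = i].
  by split; rewrite ?reg_den //; [case: rdy|move=> k; rewrite arr_den..].
have s1B : reg s1 rBest = b by [].
have s2a := releaseP s10 s1B.
set s2 := den (PFor rJ release_step) s1 in s2a.
have [s2p s2B s2I] : [/\ forall k, arr s2 aPrice k = arr s aPrice k,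
   reg s2 rBest = b & reg s2 rI = i].
  by rewrite /s2; split=> [k||]; [rewrite arr_den|rewrite reg_den..].
have bidE : den bid s = set_arr (set_arr s2 aSucc i b) aPrice b (arr s2 aPrice b + 1).
  by rewrite -s2B -s2I.
rewrite {}bidE in rdy' *.
have a'E k : k <= n -> arr (set_arr (set_arr s2 aSucc i b) aPrice b (arr s2 aPrice b + 1)) aSucc k
     = if k == i then b else if arr s aSucc k == b then n.+1 else arr s aSucc k.
  by move=> kn; rewrite /= s2a // s1a.
have p'E j : j <= n -> arr (set_arr (set_arr s2 aSucc i b) aPrice b (arr s2 aPrice b + 1)) aPrice j
     = if j == b then (arr s aPrice b).+1 else arr s aPrice j.
  by move=> jn; rewrite /= !s2p addn1.
split; last exact: auction_bid_price b_n p'E.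
split=> //; exact: (auction_bid (fun i j _ _ => scaled_weight_le i j) inv i_n ai b_n best a'E p'E).
Qed.

Definition all_assigned s := forall i, i <= n -> arr s aSucc i <= n.

Lemma auction_state_frame s s' : auction_state s ->
  reg s' rSize = reg s rSize -> arr s' = arr s -> auction_state s'.
Proof.
by rewrite /auction_state => -[rdy inv] s'0 e; rewrite e; split=> //;
  apply: (ready_frame rdy) => *; rewrite ?e.
Qed.

Lemma auction_state_set s x k : auction_state s -> x != rSize ->
  auction_state (set_reg s x k).
Proof.
by move=> st x0; apply: auction_state_frame st _ _ => //=; rewrite eq_sym (negPf x0).
Qed.

(** m counts passes; prices stop rising once every bidder has an object. *)
Definition progress m s := auction_state s /\ (all_assigned s \/ m <= price_sum s).

Lemma bid_if_unassignedP s : auction_state s -> reg s rI <= n ->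
  if arr s aSucc (reg s rI) == n.+1 then
    auction_state (den bid_if_unassigned s) /\
    price_sum (den bid_if_unassigned s) = (price_sum s).+1
  else den bid_if_unassigned s = s.
Proof.
move=> st i_n; case: eqP => e.
  have -> : den bid_if_unassigned s = den bid s.
    by rewrite /bid_if_unassigned den_if [eval _ _]/= st.1.1 addn1 e eqxx.
  exact: bidP.
by rewrite /bid_if_unassigned den_if [eval _ _]/= st.1.1 addn1 (negPf (introN eqP e)).
Qed.

Lemma auction_passP s m : progress m s -> progress m.+1 (den auction_pass s).
Proof.
move=> [st]; have s0 := st.1.1.
case: (boolP [forall i : 'I_n.+1, arr s aSucc i <= n]) => [/forallP done_ _|].
  have alls : all_assigned s by move=> i i_n; apply: (done_ (Ordinal (i_n : i < n.+1))).
  suff [st' all'] : auction_state (den auction_pass s) /\ all_assigned (den auction_pass s).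
    by split=> //; left.
  apply: (@for_preserved (fun s => auction_state s /\ all_assigned s) n) => //.
  move=> s' s'0 i_n [st' all']; have := bid_if_unassignedP st' i_n.
  by case: eqP => [e|_ -> //]; have := all' _ i_n; rewrite e ltnn.
rewrite negb_forall => /existsP[i0 i0N] [/(_ i0)|le_m].
  by rewrite (negPf i0N) -ltnS => /(_ (ltn_ord _)).
have ai0 : arr s aSucc i0 = n.+1.
  have := assigned_le st.2 (i := i0); rewrite -ltnS => /(_ (ltn_ord _)).
  by rewrite leq_eqVlt ltnS (negPf i0N) orbF => /eqP.
suff [st' lt'] : auction_state (den auction_pass s) /\ m < price_sum (den auction_pass s).
  by split=> //; right.
(* Bidder [i0] is unassigned before the pass. When its turn comes, either a bid has already been
   made or it is still unassigned and bids. *)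
apply: (@for_reach (fun s => [/\ auction_state s, m <= price_sum s &
    m < price_sum s \/ arr s aSucc i0 = n.+1])
  (fun s => auction_state s /\ m < price_sum s) n _ _ _ i0) => //.
- by rewrite -ltnS.
- move=> s' s'0 i_n [st' le' lt']; have := bid_if_unassignedP st' i_n.
  case: eqP => _ => [[st'' sum'']|->] //.
  by split; rewrite ?sum'' //; [apply: leqW | left].
- move=> s' s'0 i_n [st' lt']; have := bid_if_unassignedP st' i_n.
  case: eqP => _ => [[st'' sum'']|->] //.
  by split; rewrite ?sum'' //; apply: leqW.
- move=> s' s'0 i_i0 [st' le' lt']; have := bid_if_unassignedP st'.
  rewrite i_i0 -ltnS => /(_ (ltn_ord _)).
  case: eqP lt' => [_ _ [st'' sum'']|ne [lt'|//] ->] //.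
  by split; rewrite ?sum''.
- by split=> //; right.
Qed.

Lemma auctionP s : 0 < n -> auction_state s ->
  auction_state (den auction s) /\ all_assigned (den auction s).
Proof.
move=> n0 st.
have prog0 : progress 0 s by split=> //; right.
have pset x : x != rSize -> forall s' m k, progress m s' -> progress m (set_reg s' x k).
  by move=> x0 s' m k [st' H]; split=> //; apply: auction_state_set.
have s0 := st.1.1.
have [st' [//|le_sum]] :
    progress (0 + n.+1 * (n.+1 * (n.+1 * (n.+1 * (n.+1 * 1))))) (den auction s).
  rewrite /auction.
  do 5!(apply: for_progress => //; move=> {prog0}? ? ? prog0).
  by rewrite addn1; apply: auction_passP.
(* Otherwise (n + 1)^5 would be at most (n + 1) ((n + 2)^2 + 1), which is false for n > 0. *)
exfalso; have := leq_trans le_sum (auction_price_bound st'.2).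
rewrite add0n leq_mul2l /= muln1 /weight_bound.
have : 4 * (n.+1 * n.+1) <= n.+1 * (n.+1 * (n.+1 * n.+1)).
  by rewrite [leqRHS]mulnA leq_mul2r; apply/orP; right; nia.
nia.
Qed.

End Program.

(** * The search for rotations *)

Local Notation rA := 17 (only parsing).
Local Notation rB := 18 (only parsing).
Local Notation rC := 19 (only parsing).
Local Notation rD := 20 (only parsing).
Local Notation rTmp := 21 (only parsing).
Local Notation rOldSum := 22 (only parsing).
Local Notation rNewSum := 23 (only parsing).
Local Notation rX := 24 (only parsing).
Local Notation rOldLen := 25 (only parsing).
Local Notation rNewLen := 26 (only parsing).
Local Notation rPass := 27 (only parsing).
Local Notation rY := 28 (only parsing).
Local Notation rPos := 29 (only parsing).

Definition copy_array (a b : nat) : prog := PFor rI (PArr b (Reg rI) (Arr a (Reg rI))).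

Definition swap_entries (x y : nat) : prog :=
  PReg rTmp (Arr aCand (Reg x));;
  PArr aCand (Reg x) (Arr aCand (Reg y));;
  PArr aCand (Reg y) (Reg rTmp).

Definition candidate : prog :=
  copy_array aSucc aCand;;
  swap_entries rA rB;; swap_entries rB rC;; swap_entries rC rD.

Definition sum_weights (a r : nat) : prog :=
  PReg r (Defs.Num 0);;
  PFor rI (PReg r (Add (Reg r) (cell (Reg rI) (Arr a (Reg rI))))).

Definition walk_step (a r : nat) : prog :=
  PIf (Lt (Reg rX) (Reg rSize))
    (PReg r (Add (Reg r) (Defs.Num 1));; PReg rX (Arr a (Reg rX))) PSkip.

(* The length minus one of the cycle through z. *)
Definition walk (a r : nat) : prog :=
  PReg r (Defs.Num 0);; PReg rX (Arr a (Reg rSize));; PFor rI (walk_step a r).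

Definition measure_both : prog :=
  sum_weights aSucc rOldSum;; sum_weights aCand rNewSum;;
  walk aSucc rOldLen;; walk aCand rNewLen.

(** An optimal permutation has the greatest weight, so a candidate of no smaller weight is optimal
    again; the lengths decide whether it is a gain. *)
Definition try_rotation : prog :=
  candidate;; measure_both;;
  PIf (Lt (Reg rNewSum) (Reg rOldSum)) PSkip
    (PIf (Lt (Reg rOldLen) (Reg rNewLen)) (copy_array aCand aSucc) PSkip).

Definition rotations : prog := PFor rPass (nest [:: rA; rB; rC; rD] try_rotation).

Section Rotations.
Variables (n : nat) (D : rel 'I_n).

Local Notation apex := (@ord_max n).
Local Notation arc := (lift_arc D (@embed n)).

Definition codes s a (p : {perm 'I_n.+1}) := forall x : 'I_n.+1, arr s a x = p x.

Lemma copy_arrayP s a b p : a != b -> reg s rSize = n -> codes s a p ->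
  codes (den (copy_array a b) s) b p.
Proof.
move=> ab s0 sp.
pose I m s' := codes s' a p /\ forall x : 'I_n.+1, x < m -> arr s' b x = p x.
suff [_ H] : I n.+1 (den (copy_array a b) s) by move=> x; apply: H.
apply: (@for_rule I n) => //.
move=> m s' mn s'0 s'I [s'p s'b]; split=> x /=; rewrite s'I.
  by rewrite (negPf ab) s'p.
rewrite ltnS leq_eqVlt eqxx /=; case: (x =P m :> nat) => [<- _|_ /= xm]; first exact: s'p.
exact: s'b.
Qed.

Lemma swap_entriesP s x y (a b : 'I_n.+1) p : x != rTmp -> y != rTmp ->
  codes s aCand p -> reg s x = a -> reg s y = b ->
  codes (den (swap_entries x y) s) aCand (swap p a b).
Proof.
move=> xT yT sp sx sy z.
rewrite /swap_entries /= (negPf xT) (negPf yT) sx sy !sp swapE.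
rewrite !val_eqE; case: tpermP => [->|->|/eqP/negPf-> /eqP/negPf-> //].
  by rewrite eqxx; case: eqP => // ->.
by rewrite eqxx.
Qed.

Lemma sum_weightsP s a r p : r != rSize -> r != rI -> ready D s -> codes s a p ->
  reg (den (sum_weights a r) s) r = n.+2 * \sum_x weight D apex (@embed n) x (p x).
Proof.
move=> r0 rI' rdy sp.
pose I m s' := [/\ ready D s', codes s' a p &
  reg s' r = \sum_(0 <= i < m) scaled_weight D i (arr s a i)].
suff [_ _ ->] : I n.+1 (den (sum_weights a r) s).
  rewrite big_mkord big_distrr; apply: eq_bigr => x _.
  by rewrite /scaled_weight sp !inord_val.
have [s0 _] := rdy; rewrite /sum_weights den_seq; apply: (@for_rule I n) => //.
- by rewrite /= inE eq_sym rI' r0.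
- by move: r0; rewrite /= eq_sym => /negPf->.
- rewrite /I /= (negPf rI') eqxx big_nil; split=> //.
  by apply: (ready_frame rdy) => //=; rewrite eq_sym (negPf r0).
move=> m s' mn s'0 s'I [rdy' s'p s'r]; split => //.
- by apply: (ready_frame rdy') => //=; rewrite eq_sym (negPf r0).
- rewrite /= (negPf rI') eqxx s'r s'I big_nat_recr //=.
  have [_ wt] := rdy'.
  pose m' : 'I_n.+1 := Ordinal (mn : m < n.+1).
  rewrite -[m]/(val m') s'p sp wt //=.
  by rewrite -ltnS.
Qed.

Lemma walkP s a r (p : {perm 'I_n.+1}) : r != rSize -> r != rI -> r != rX ->
  reg s rSize = n -> codes s a p ->
  (reg (den (walk a r) s) r).+1 = forder p apex.
Proof.
move=> r0 rI' rX' s0 sp; have [k ordk] : exists k, forder p apex = k.+1.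
  by exists (forder p apex).-1; rewrite prednK // fingraph.order_gt0.
(* The cycle has k.+1 points. The walk starts at the image of the apex, reaches the apex after k
   moves and idles from then on. *)
pose I m s' := [/\ reg s' rSize = n, codes s' a p, reg s' r = minn m k &
  reg s' rX = iter (minn m k).+1 p apex].
have kn : k <= n.+1 by rewrite -ltnS -ordk (leq_trans (max_card _)) // card_ord.
suff [_ _ -> _] : I n.+1 (den (walk a r) s) by rewrite (minn_idPr kn) ordk.
have r9 : (9 == r) = false by rewrite eq_sym (negPf rI').
have r00 : (0 == r) = false by rewrite eq_sym (negPf r0).
have r24 : (24 == r) = false by rewrite eq_sym (negPf rX').
rewrite /walk !den_seq; apply: (@for_rule I n) => //.
- by rewrite /= !inE !negb_or eq_sym rI' r0.
- by rewrite /= [0 == r]eq_sym (negPf r0).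
- rewrite /I /= r00 (negPf rI') (negPf rX') min0n eqxx s0; split=> //.
  by rewrite -[n]/(val apex) sp.
move=> m s' mn s'0 s'I [_ s'p s'r s'X].
rewrite /I /walk_step /= s'X s'0.
have [mk|km] := boolP (m < k); last rewrite -leqNgt in km.
  rewrite (minn_idPl (ltnW mk)) (minn_idPl mk).
  have Xn : iter m.+1 p apex < n.
    rewrite ltn_neqAle -ltnS ltn_ord andbT.
    have := @iter_perm_neq _ apex p 0 m.+1 isT.
    by rewrite ordk ltnS => /(_ mk); rewrite -val_eqE.
  rewrite Xn /= ?r9 ?r00 ?r24 ?(negPf rX') ?s'X ?eqxx ?(negPf rI').
  by rewrite s'r (minn_idPl (ltnW mk)) addn1 -iterS -[p (iter m.+1 p apex)]/(iter m.+2 p apex) s'p.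
have kE : iter k.+1 p apex = apex by rewrite -ordk iter_order //; apply: perm_inj.
rewrite (minn_idPr km) (minn_idPr (leqW km)) kE /= ltnn /=.
by rewrite ?(negPf rI') ?s'X ?s'r ?(minn_idPr km).
Qed.

Local Notation wsum p := (\sum_x weight D apex (@embed n) x (p x)).

Lemma codes_frame s s' a p : (forall i, arr s' a i = arr s a i) ->
  codes s a p -> codes s' a p.
Proof. by move=> e sp x; rewrite e. Qed.

Lemma codes_den c s a p : a \notin written_arrs c -> codes s a p -> codes (den c s) a p.
Proof. by move=> ac; apply: codes_frame => i; rewrite arr_den. Qed.

Lemma candidateP s p (a b c d : 'I_n.+1) : reg s rSize = n -> codes s aSucc p ->
  reg s rA = a -> reg s rB = b -> reg s rC = c -> reg s rD = d ->
  codes (den candidate s) aCand (rotate p a b c d).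
Proof.
move=> s0 sp sA sB sC sD; rewrite /candidate 3!den_seq.
have cp := @copy_arrayP s aSucc aCand p isT s0 sp.
by do 3!(apply: swap_entriesP => //; rewrite ?reg_den //).
Qed.

Lemma measure_bothP s p q : ready D s -> codes s aSucc p -> codes s aCand q ->
  let s' := den measure_both s in
  [/\ reg s' rOldSum = n.+2 * wsum p, reg s' rNewSum = n.+2 * wsum q,
      (reg s' rOldLen).+1 = forder p apex & (reg s' rNewLen).+1 = forder q apex].
Proof.
move=> rdy sp sq s'; have [s0 _] := rdy.
rewrite {}/s' /measure_both 3!den_seq; split.
- by do 3!(rewrite reg_den //); apply: sum_weightsP.
- do 2!(rewrite reg_den //).
  by apply: sum_weightsP => //; [apply: ready_den | apply: codes_den].
- rewrite reg_den //; apply: walkP => //; first by rewrite !reg_den.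
  by do 2!(apply: codes_den => //).
- apply: walkP => //; first by rewrite !reg_den.
  by do 3!(apply: codes_den => //).
Qed.

Lemma try_rotationP s p (a b c d : 'I_n.+1) (q := rotate p a b c d) :
  ready D s -> codes s aSucc p ->
  reg s rA = a -> reg s rB = b -> reg s rC = c -> reg s rD = d ->
  ready D (den try_rotation s) /\
  codes (den try_rotation s) aSucc
    (if (wsum p <= wsum q) && (forder p apex < forder q apex) then q else p).
Proof.
move=> rdy sp sA sB sC sD; split; first exact: ready_den.
have [s0 _] := rdy.
have s1q := candidateP s0 sp sA sB sC sD; rewrite -/q in s1q.
have s1p : codes (den candidate s) aSucc p by apply: codes_den.
have s1r : ready D (den candidate s) by apply: ready_den.
rewrite /try_rotation 2!den_seq; move: (den candidate s) s1q s1p s1r => s1 s1q s1p s1r.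
have [m1 m2 m3 m4] := measure_bothP s1r s1p s1q.
have s2q : codes (den measure_both s1) aCand q by apply: codes_den.
have s2p : codes (den measure_both s1) aSucc p by apply: codes_den.
have s20 : reg (den measure_both s1) 0 = n by rewrite reg_den //; case: s1r.
move: (den measure_both s1) m1 m2 m3 m4 s2q s2p s20 => s2 m1 m2 m3 m4 s2q s2p s20.
rewrite !den_if ![eval _ _]/= m1 m2 -m3 -m4 ltnS ltn_mul2l /=.
case: ltnP => _ //=; case: ltnP => _ //=.
exact: (@copy_arrayP s2 aCand aSucc).
Qed.

Variable P : {set {set 'I_n}}.
Hypothesis smd : semicomplete_multipartite D P.
Hypothesis n_gt0 : 0 < n.

Lemma embed_inj : injective (@embed n).
Proof. by move=> u v /(congr1 val) /= e; apply: val_inj. Qed.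

Lemma embed_apex v : embed v != apex.
Proof. by rewrite -val_eqE /= ltn_eqF. Qed.

Lemma embed_onto x : x != apex -> exists v : 'I_n, x = embed v.
Proof.
rewrite -val_eqE /= => xn; have lt_xn : x < n by rewrite ltn_neqAle xn -ltnS /=.
by exists (Ordinal lt_xn); apply: val_inj.
Qed.

Lemma auction_optimal s : auction_state D s -> all_assigned n s ->
  exists2 p, codes s aSucc p & optimal D apex (@embed n) p.
Proof.
move=> [_ inv] /(auction_final inv)[p sp max_p]; exists p => //.
apply: (weight_optimal smd embed_inj embed_apex embed_onto); first by rewrite card_ord.
move=> t; have := max_p t; rewrite /scaled_weight.
under eq_bigr do rewrite !inord_val.
under [X in _ <= X + _ -> _]eq_bigr do rewrite !inord_val.
rewrite -!big_distrr /= => le_t; rewrite -ltnS -(@ltn_pmul2l n.+2) //.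
by rewrite mulnS [n.+2 + _]addnC; apply: leq_ltn_trans le_t _; rewrite ltn_add2l.
Qed.

Definition long m s := ready D s /\ exists p,
  [/\ codes s aSucc p, optimal D apex (@embed n) p & m <= forder p apex].

Lemma optimal_rotate_weight (p q : {perm 'I_n.+1}) :
  optimal D apex (@embed n) p -> wsum p <= wsum q -> optimal D apex (@embed n) q.
Proof.
move=> opt le_pq.
apply: (weight_optimal smd embed_inj embed_apex embed_onto); first by rewrite card_ord.
by move=> t; apply: leq_trans (optimal_weight t opt) le_pq.
Qed.

Lemma long_set m s x k : x != rSize -> long m s -> long m (set_reg s x k).
Proof.
move=> x0 [rdy sp]; split=> //; apply: ready_frame rdy _ _ _ => //=.
by rewrite eq_sym (negPf x0).
Qed.

Lemma loop_range_ord s xs : loop_range n xs s -> forall x, x \in xs ->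
  exists a : 'I_n.+1, reg s x = a.
Proof. by move=> s_xs x /s_xs xn; exists (Ordinal (xn : reg s x < n.+1)). Qed.

Lemma try_rotation_long m s : loop_range n [:: rA; rB; rC; rD] s ->
  long m s -> long m (den try_rotation s).
Proof.
move=> /loop_range_ord range [rdy [p [sp opt le_m]]].
have [a sA] := range rA isT; have [b sB] := range rB isT.
have [c sC] := range rC isT; have [d sD] := range rD isT.
have [rdy' sq] := try_rotationP rdy sp sA sB sC sD.
split=> //; exists (if (wsum p <= wsum (rotate p a b c d)) &&
  (forder p apex < forder (rotate p a b c d) apex) then rotate p a b c d else p).
split=> //; case: ifP => // /andP[le_w lt_o].
  exact: optimal_rotate_weight opt le_w.
exact: leq_trans le_m (ltnW lt_o).
Qed.

Lemma rotation_passP m s : m <= n -> long m s ->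
  long m.+1 (den (nest [:: rA; rB; rC; rD] try_rotation) s).
Proof.
move=> mn [rdy [p [sp opt le_m]]]; have [s0 _] := rdy.
have x0 x : x \in [:: rA; rB; rC; rD] -> x != rSize by case: x.
move: le_m; rewrite leq_eqVlt => /predU1P[ordp|lt_m]; last first.
  apply: (@nest_preserved (long m.+1) n _ [::]) => //.
  - by move=> s' x k /x0 xN; apply: long_set.
  - by move=> s' _ range; apply: try_rotation_long.
  - by split=> //; exists p.
have lt_ord : forder p apex < #|'I_n.+1| by rewrite -ordp card_ord ltnS.
have [a [b [c [d [opt' lt']]]]] :=
  optimal_merge smd embed_inj embed_apex embed_onto opt lt_ord.
(* Sends [rA], [rB], [rC], [rD] to a, b, c, d, the last as the default of [nth]. *)
pose v (x : nat) := nat_of_ord (nth d [:: a; b; c] (x - rA)).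
(* Another quadruple may succeed earlier; if none does, the array still holds p when a, b, c, d come
   up. *)
apply: (@nest_reach (fun s => ready D s /\ codes s aSucc p \/ long m.+1 s) (long m.+1)
  n v _ [::]) => //.
- by apply/allP => x _; rewrite -ltnS ltn_ord.
- move=> s' x k /x0 xN [[rdy' sp']|/(long_set k xN)]; last by right.
  by left; split=> //; apply: ready_frame rdy' _ _ _ => //=; rewrite eq_sym (negPf xN).
- by move=> s' x k /x0 xN; apply: long_set.
- move=> s' s'0 range [[rdy' sp']|]; last by right; apply: try_rotation_long.
  have range' := loop_range_ord range.
  have [a' sA] := range' rA isT; have [b' sB] := range' rB isT.
  have [c' sC] := range' rC isT; have [d' sD] := range' rD isT.
  have [rdy'' sq] := try_rotationP rdy' sp' sA sB sC sD.
  move: sq; case: ifP => [/andP[le_w lt_o] sq|_ sp'']; last by left.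
  right; split=> //; exists (rotate p a' b' c' d'); split=> //.
    exact: optimal_rotate_weight opt le_w.
  by rewrite ordp.
- by move=> s' s'0 range; apply: try_rotation_long.
- move=> s' s'0 val_s [[rdy' sp']|long']; last first.
    apply: try_rotation_long => // x /[dup] xin /val_s ->.
    by rewrite -ltnS ltn_ord.
  have [sA sB sC sD] := And4 (val_s rA isT) (val_s rB isT) (val_s rC isT) (val_s rD isT).
  have [rdy'' sq] := @try_rotationP s' p a b c d rdy' sp' sA sB sC sD.
  split=> //; exists (rotate p a b c d); split=> //; last by rewrite ordp.
  by move: sq; rewrite lt' (optimal_weight p opt').
- by left.
Qed.

Lemma rotationsP s : long 0 s -> long n.+1 (den rotations s).
Proof.
move=> long0; have s0 := long0.1.1.
apply: (@for_rule long n) => //.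
move=> i s' i_n _ _ /(rotation_passP i_n) long'.
exact: long_set.
Qed.

End Rotations.

(* A weight above the base weight means that rY -> rX is an arc; otherwise a
   new path starts. *)
Definition emit : prog :=
  PArr aOut (Reg rPos) (Reg rX);; PReg rPos (Add (Reg rPos) (Defs.Num 1));;
  PIf (Lt (Reg rBase) (cell (Reg rY) (Reg rX))) PSkip
    (PReg rCount (Add (Reg rCount) (Defs.Num 1)));;
  PArr aLen (Defs.Sub (Reg rCount) (Defs.Num 1))
    (Add (Arr aLen (Defs.Sub (Reg rCount) (Defs.Num 1))) (Defs.Num 1));;
  PReg rY (Reg rX);; PReg rX (Arr aSucc (Reg rX)).

Definition emit_if_inner : prog := PIf (Lt (Reg rX) (Reg rSize)) emit PSkip.

Definition emit_paths : prog :=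
  PReg rPos (Defs.Num 0);; PReg rY (Reg rSize);; PReg rX (Arr aSucc (Reg rSize));;
  PFor rI emit_if_inner.

Definition max_gpath_program : prog :=
  init_rows;; init_weights;; auction;; rotations;; emit_paths.

(** * Correctness of the output *)

Lemma eq_in_mkseq (A : Type) (f g : nat -> A) m :
  (forall i, i < m -> f i = g i) -> mkseq f m = mkseq g m.
Proof.
move=> fg; apply: (@eq_from_nth _ (f 0)); rewrite ?size_mkseq // => i im.
by rewrite !nth_mkseq ?fg.
Qed.

Section Output.
Variable n : nat.
Implicit Types (s : state) (ps qs : seq (seq 'I_n)).

(** The zeros beyond [ps] give a new path its initial length 0. *)
Definition output_so_far s ps :=
  outputs_paths s ps /\ forall i, size ps <= i -> arr s aLen i = 0.

Lemma output_new_path s s' ps v : output_so_far s ps ->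
  reg s' rCount = (reg s rCount).+1 ->
  (forall i, arr s' aLen i = if i == reg s rCount then (arr s aLen i).+1 else arr s aLen i) ->
  (forall i, arr s' aOut i = if i == size (flatten ps) then val v else arr s aOut i) ->
  output_so_far s' (rcons ps [:: v]).
Proof.
move=> [[count len out] zero] count' len' out'; split.
  split.
  - by rewrite count' count size_rcons.
  - rewrite size_rcons mkseqS map_rcons len' count eqxx zero //; congr rcons.
    by rewrite -len; apply: eq_in_mkseq => i im; rewrite len' count ltn_eqF.
  - rewrite flatten_rcons size_cat addn1 mkseqS out' eqxx map_cat cats1; congr rcons.
    by rewrite -out; apply: eq_in_mkseq => i im; rewrite out' ltn_eqF.
move=> i; rewrite size_rcons => im; rewrite len' count gtn_eqF // zero //.
exact: ltnW.
Qed.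

Lemma output_extend_path s s' qs q v : output_so_far s (rcons qs q) ->
  reg s' rCount = reg s rCount ->
  (forall i, arr s' aLen i =
     if i == (reg s rCount).-1 then (arr s aLen i).+1 else arr s aLen i) ->
  (forall i, arr s' aOut i =
     if i == size (flatten (rcons qs q)) then val v else arr s aOut i) ->
  output_so_far s' (rcons qs (rcons q v)).
Proof.
move=> [[count len out] zero] count' len' out'.
rewrite count size_rcons in len' count'; split.
  split.
  - by rewrite count' size_rcons.
  - move: len; rewrite !size_rcons !mkseqS !map_rcons => /rcons_inj[lens lenq].
    rewrite len' eqxx lenq size_rcons; congr rcons.
    by rewrite -lens; apply: eq_in_mkseq => i im; rewrite len' ltn_eqF.
  - rewrite flatten_rcons -rcons_cat -flatten_rcons size_rcons mkseqS out' eqxx map_rcons.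
    congr rcons.
    by rewrite -out; apply: eq_in_mkseq => i im; rewrite out' ltn_eqF.
move=> i; rewrite size_rcons => im; rewrite len' gtn_eqF // zero //.
by rewrite size_rcons.
Qed.

End Output.

Section Emit.
Variables (n : nat) (D : rel 'I_n) (P : {set {set 'I_n}}) (p : {perm 'I_n.+1}).
Hypothesis smd : semicomplete_multipartite D P.
Hypothesis adm_p : admissible_perm (@ord_max n) (lift_arc D (@embed n)) p.
Hypothesis full : forder p (@ord_max n) = n.+1.

Local Notation apex := (@ord_max n).
Local Notation arc := (lift_arc D (@embed n)).
Local Notation visit m := (iter m p apex).

Definition emitting s := [/\ ready D s, codes s aSucc p & reg s rBase = n.+1 * n.+2].

Lemma emitP s (y : 'I_n.+1) : emitting s -> reg s rY = y -> reg s rX = p y ->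
  let s' := den emit s in
  let c := reg s rCount + ~~ arc y (p y) in
  [/\ emitting s', reg s' rY = p y /\ reg s' rX = p (p y),
      reg s' rPos = (reg s rPos).+1,
      reg s' rCount = c &
      (forall i, arr s' aLen i = if i == c.-1 then (arr s aLen i).+1 else arr s aLen i) /\
      (forall i, arr s' aOut i = if i == reg s rPos then val (p y) else arr s aOut i)].
Proof.
move=> [rdy sp sB] sY sX s' c; have [s0 wt] := rdy.
have rdy' : ready D s' by apply: ready_den.
have sp' : codes s' aSucc p by apply: codes_den.
have le_n (x : 'I_n.+1) : x <= n by rewrite -ltnS ltn_ord.
have cellE : (reg s rBase < arr s aWt (arr s aRow (reg s rY) + reg s rX)) = arc y (p y).
  rewrite sY sX sB wt ?le_n // /scaled_weight !inord_val /weight card_ord.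
  have /forallP/(_ y) -> := adm_p.
  rewrite [n.+1 * _]mulnC ltn_pmul2l //; case: (arc _ _); last by rewrite addn0 ltnn.
  by rewrite addn1 ltnSn.
rewrite sX in cellE; split; first by split=> //; rewrite reg_den.
all: rewrite /s' /c {s' c rdy' sp'} /emit /= ?sX ?cellE; case: (arc y (p y)) => //=.
all: rewrite ?addn0 ?addn1 ?subn1 ?sX //.
all: by split=> // i; case: eqP => // ->.
Qed.

(** A G-path has at least one vertex, so [traces] cannot hold at m = 0. *)
Definition traced m ps :=
  if m is 0 then ps = [::] else traces D P apex (@embed n) p m ps.

Lemma traced_traces m ps : 0 < m -> traced m ps -> traces D P apex (@embed n) p m ps.
Proof. by case: m. Qed.

Lemma traced_size m ps : traced m ps -> size (flatten ps) = m.
Proof.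
case: m => [->//|m [_ /(congr1 size)]].
by rewrite size_map size_traject.
Qed.

Lemma emit_traced s m ps : emitting s -> reg s rY = visit m -> reg s rX = visit m.+1 ->
  reg s rPos = m -> m < n -> traced m ps -> output_so_far s ps ->
  exists2 ps', traced m.+1 ps' & output_so_far (den emit s) ps'.
Proof.
move=> em sY sX sPos mn tr out.
have [_ _ _ count' [len' outs']] := emitP em sY sX.
move: (den emit s) count' len' outs' => s' count' len' outs'.
have [v vE] : exists v, visit m.+1 = embed v.
  by apply: embed_onto; apply: (@iter_perm_neq _ apex p 0 m.+1); rewrite ?full.
have [[count len _] _] := out.
have {}outs' i : arr s' aOut i =
    if i == size (flatten ps) then val v else arr s aOut i.
  by rewrite outs' sPos (traced_size tr) -[p (visit m)]/(visit m.+1) vE.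
rewrite -[p (visit m)]/(visit m.+1) in len' count'.
case: m => [|m] in sY sX sPos mn tr vE len' count' outs' *.
  rewrite tr /= in out count outs' *; exists [:: [:: v]].
    exact: (traces1 D P (@embed_apex n)).
  (* The move out of z is no arc, so the test for a new path also opens the first one. *)
  have [/negPf noarc _] := lift_arc_apex D (@embed_apex n) (visit 1).
  rewrite noarc /= addn1 /= in len' count'.
  by apply: (output_new_path out).
case/lastP: ps => [[/andP[/and3P[]]]//|qs q] in tr out count outs' len *.
have m2 : m.+2 < forder p apex by rewrite full.
have [uE tr'] := traces_step smd (@embed_inj n) (@embed_apex n) adm_p m2 tr vE.
eexists; first exact: tr'.
rewrite vE -uE lift_arc_inj in len' count'; last exact: embed_inj.
case: (D _ _) len' count' => /=; rewrite ?addn0 ?addn1 /= => len' count'.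
  exact: (output_extend_path out).
exact: (output_new_path out).
Qed.

Lemma emit_pathsP s : ready D s -> codes s aSucc p -> reg s rBase = n.+1 * n.+2 ->
  reg s rCount = 0 -> (forall i, arr s aLen i = 0) ->
  exists2 ps, outputs_paths (den emit_paths s) ps & traced n ps.
Proof.
move=> rdy sp sB sC sL; have [s0 _] := rdy.
(* Only n of the n.+1 rounds find a vertex; in the last one [rX] holds z and nothing is written,
   whence [minn m n]. *)
pose I m s := exists ps, [/\ emitting s, reg s rPos = minn m n,
  reg s rY = visit (minn m n) /\ reg s rX = visit (minn m n).+1,
  traced (minn m n) ps & output_so_far s ps].
suff [ps [_ _ _ tr [out _]]] : I n.+1 (den emit_paths s).
  by exists ps => //; move: tr; rewrite (minn_idPr (leqnSn n)).
rewrite /emit_paths 3!den_seq; apply: (@for_rule I n) => //.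
  exists [::]; rewrite min0n; split=> //=.
    by rewrite s0; split=> //; rewrite -[n]/(val apex) sp.
  by split=> [|i _]; [split | apply: sL].
move=> m s' mn s'0 s'I [ps [em sPos [sY sX] tr out]].
rewrite /emit_if_inner den_if [eval _ _]/= sX s'0.
have [lt_mn|ge_mn] := boolP (m < n); last first.
  have {mn}mn : m = n by apply/eqP; rewrite eqn_leq mn leqNgt.
  have -> : visit (minn m n).+1 < n = false.
    have := iter_order (@perm_inj _ p) apex; rewrite full => e.
    by rewrite mn minnn e /= ltnn.
  exists ps; move: em sPos sY sX tr out.
  by rewrite mn minnn (minn_idPr (leqnSn n)) /=; split.
rewrite (minn_idPl (ltnW lt_mn)) in sPos sY sX tr *.
have Xn : visit m.+1 < n.
  rewrite ltn_neqAle -ltnS ltn_ord andbT.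
  have := @iter_perm_neq _ apex p 0 m.+1 isT.
  by rewrite full ltnS => /(_ lt_mn); rewrite -val_eqE.
have [ps' tr' out'] := emit_traced em sY sX sPos lt_mn tr out.
have [em' [sY' sX'] sPos' _ _] := emitP em sY sX.
move: (den emit s') out' em' sY' sX' sPos' => s2 out' em' sY' sX' sPos'.
exists ps'; rewrite Xn (minn_idPl lt_mn); split=> //.
by rewrite /= sPos' sPos.
Qed.

End Emit.

Lemma max_gpath_programP (n : nat) (D : rel 'I_n) :
  0 < n -> (exists P : {set {set 'I_n}}, semicomplete_multipartite D P) ->
  exists2 ps, outputs_paths (den max_gpath_program (input_digraph D)) ps &
    forall P : {set {set 'I_n}}, semicomplete_multipartite D P -> maximum_gpath D P ps.
Proof.
move=> n_gt0 [P0 smd0].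
have ini1 := init_rowsP D; set s1 := den init_rows (input_digraph D) in ini1.
have s10 : reg s1 0 = n by rewrite /s1 reg_den.
have [ini2 rdy2] := init_weightsP ini1 s10; set s2 := den init_weights s1 in ini2 rdy2.
have st2 : auction_state D s2.
  split=> //; have [_ _ _ _ [succ [price _]]] := ini2.
  split.
  - by move=> i i_n; rewrite succ.
  - by move=> i i' i_n _; rewrite succ // ltnn.
  - by move=> i j i_n _; rewrite succ // ltnn.
  - by move=> j jn; rewrite price.
  - by move=> j jn; rewrite price.
have [st3 all3] := auctionP n_gt0 st2; set s3 := den auction s2 in st3 all3.
have [p3 sp3 opt3] := auction_optimal smd0 n_gt0 st3 all3.
have long3 : long D 0 s3 by split; [exact: st3.1 | exists p3].
have [rdy4 [p [sp4 opt4 long4]]] := rotationsP smd0 n_gt0 long3.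
have full : forder p (@ord_max n) = n.+1.
  by apply/eqP; rewrite eqn_leq long4 andbT -[leqRHS](card_ord n.+1) max_card.
have [ps out tr] : exists2 ps, outputs_paths (den max_gpath_program (input_digraph D)) ps
    & traced D P0 p n ps.
  rewrite /max_gpath_program 4!den_seq -/s1 -/s2 -/s3.
  have [_ rB _ _ [_ [_ [rC len]]]] := ini2.
  apply: emit_pathsP => //; first exact: opt4.1.
  - by rewrite reg_den // reg_den.
  - by rewrite reg_den // reg_den.
  - by move=> i; rewrite arr_den // arr_den.
exists ps => // P smd.
(* The run is analysed for [P0]; links depend on nonadjacency alone, so every [P] has the same
   G-paths. *)
have linkedP : linked P =2 linked P0.
  move=> [|x q] [|y r] //=.
  by rewrite (same_part_nonadjacent smd) (same_part_nonadjacent smd0).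
have gpathP qs : is_gpath D P qs = is_gpath D P0 qs.
  by rewrite /is_gpath (eq_sorted linkedP).
have traceP : traces D P0 (@ord_max n) (@embed n) p #|'I_n.+1|.-1 ps.
  by rewrite card_ord; apply: traced_traces.
have fullT : forder p (@ord_max n) = #|'I_n.+1| by rewrite card_ord.
have [gps arcs] := traces_full (@embed_apex n) fullT traceP.
split=> [|qs]; rewrite gpathP // arcs.
exact: (gpath_le_optimal smd0 (@embed_inj n) (@embed_apex n) (@embed_onto n) opt4).
Qed.

Theorem theorem5p2 :
  (forall (V : finType) (D : rel V) (P : {set {set V}}),
      0 < #|V| -> semicomplete_multipartite D P ->
      exists m : nat,
        is_maximum (fun ps : seq (seq V) => is_gpath D P ps)
                   (@paths_arcs V) m /\
        is_maximum (fun S : seq (seq V) * seq (gcycle V) =>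
                      is_gpath_gcycles D P S)
                   (@gpath_gcycles_arcs V) m)
  /\
  paths_found_in_polytime
    (fun (n : nat) (D : rel 'I_n) =>
       0 < n /\ exists P : {set {set 'I_n}}, semicomplete_multipartite D P)
    (fun (n : nat) (D : rel 'I_n) (ps : seq (seq 'I_n)) =>
       forall P : {set {set 'I_n}}, semicomplete_multipartite D P ->
       maximum_gpath D P ps).
Proof.
split; first exact: gpath_gcycles_maximum.
apply: (@paths_found_by _ _ max_gpath_program) => // n D [n_gt0 exP].
by split=> //; apply: max_gpath_programP.
Qed.
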